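(* Let $k\ge 2$. The boundary map $\partial\colon\mathcal{TF}^{4k}_{\rm nd}\to\mathcal{Q}^{4k-1}$ is onto. That is, for every extended quadratic linking form $(G,b,q,\beta)$ over $\pi_{2k-1}\{SO(2k)\}$ there is a nondegenerate treelike extended quadratic form $(H,\lambda,\alpha)$ over $\pi_{2k-1}\{SO(2k)\}$ such that $(G,b,q,\beta)$ is isomorphic to $\partial(H,\lambda,\alpha)$.
   Context: By Bott periodicity $\pi_{2k-1}(SO)\cong\mathbb{Z},\ \mathbb{Z}/2,\ \mathbb{Z},\ 0$ for $k\equiv 0,1,2,3\bmod 4$ respectively. Extended quadratic forms: an extended quadratic form over $\pi_{2k-1}\{SO(2k)\}$ is a triple $(H,\lambda,\alpha)$ with $H$ a finitely generated free abelian group, $\lambda\colon H\times H\to\mathbb{Z}$ a symmetric bilinear form and $\alpha\colon H\to\pi_{2k-1}(SO)$ a homomorphism, such that $\lambda(x,x)\equiv\alpha(x)\bmod 2$ for all $x$ if $k=2,4$, and $\lambda(x,x)\in 2\mathbb{Z}$ for all $x$ if $k\ne 2,4$. (Equivalently, it is a triple $(H,\lambda,\mu)$ with $\mu\colon H\to\pi_{2k-1}(SO(2k))$ satisfying $\mu(x+y)=\mu(x)+\mu(y)+\lambda(x,y)\tau_{S^{2k}}$ and Euler number $e(\mu(x))=\lambda(x,x)$; $\alpha$ is the stabilisation of $\mu$.) It is nondegenerate if the adjoint $\hat\lambda\colon H\to H^*=\mathrm{Hom}(H,\mathbb{Z})$, $x\mapsto\lambda(x,\cdot)$, is injective; then $G:=\mathrm{coker}(\hat\lambda)$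 is finite; let $\pi\colon H^*\to G$ be the projection. Treelike forms: a $\mathbb{Z}$-labelled tree $\mathfrak{t}$ is a finite tree with vertices $v_1,\dots,v_r$ and an integer $a_i$ assigned to each $v_i$. It defines a symmetric bilinear form $\lambda_{\mathfrak t}$ on the free abelian group $H_{\mathfrak t}$ with basis $v_1,\dots,v_r$ by $\lambda_{\mathfrak t}(v_i,v_i)=a_i$ and, for $i\neq j$, $\lambda_{\mathfrak t}(v_i,v_j)=1$ if $v_i,v_j$ are joined by an edge and $0$ otherwise. A symmetric bilinear form is treelike if it is isomorphic to some $(H_{\mathfrak t},\lambda_{\mathfrak t})$; $(H,\lambda,\alpha)$ is treelike if $(H,\lambda)$ is. $\mathcal{TF}^{4k}_{\rm nd}$ is the set of isomorphism classes of nondegenerate treelike extended quadratic forms. Extended quadratic linking forms: an extended quadratic linking form over $\pi_{2k-1}\{SO(2k)\}$ is a quadruple $(G,b,q,\beta)$ where $G$ is a finite abelian group; $b\colon G\times G\to\mathbb{Q}/\mathbb{Z}$ is a nonsingular symmetric bilinear form ($b(x,y)=0$ for all $y$ iff $x=0$); $\beta\in(2\cdot G)\otimes\pi_{2k-1}(SO)$ if $k=2,4$ and $\beta\in G\otimes\pi_{2k-1}(SO)$ if $k\ne2,4$; and $q\colon G\to\mathbb{Q}/\mathbb{Z}$ satisfies $q(x+y)-q(x)-q(y)=b(x,y)$, with $q(x)=q(-x)$ for all $x$ if $k\neq 2,4$, and $q(x)-q(-x)=b(x,\beta)$ for all $x$ if $k=2,4$. Isomorphisms are group isomorphisms preserving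 all the data. $\mathcal{Q}^{4k-1}$ is the set of isomorphism classes. Boundary: for nondegenerate $(H,\lambda,\alpha)$ let $\lambda^{-1}\colon H^*\times H^*\to\mathbb{Q}$ be the form obtained by transporting the rational extension $\lambda_{\mathbb Q}$ along $(\hat\lambda_{\mathbb{Q}})^{-1}\colon H^*\otimes\mathbb{Q}\to H\otimes\mathbb{Q}$, i.e. $\lambda^{-1}(x,y)=\lambda_{\mathbb{Q}}(\hat\lambda_{\mathbb Q}^{-1}x,\hat\lambda_{\mathbb Q}^{-1}y)$. Then $\partial(H,\lambda,\alpha)=(G,b,q,\beta)$ with $G=\mathrm{coker}(\hat\lambda)$, $b(\pi(x),\pi(y))=\lambda^{-1}(x,y)\bmod\mathbb{Z}$; if $k=2,4$, $q(\pi(x))=\tfrac12(\lambda^{-1}(x,x)+\lambda^{-1}(x,\alpha))\bmod\mathbb{Z}$ and $\beta=\pi(\alpha)$ (with $\alpha\in H^*$); if $k\ne2,4$, $q(\pi(x))=\tfrac12\lambda^{-1}(x,x)\bmod\mathbb{Z}$, and $\beta=\pi(\alpha)\in G$ if $k$ is even, $\beta=(\pi\otimes\mathrm{id})(\alpha)\in G\otimes\mathbb{Z}/2$ (with $\alpha\in H^*\otimes\mathbb{Z}/2$) if $k\equiv1\bmod4$, and $\beta=0$ if $k\equiv3\bmod4$. *)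

(* Defs.v *)
From HB Require Import structures.
From mathcomp Require Import all_boot all_order all_algebra.
From mathcomp Require Import generic_quotient ring_quotient ring.
From mathcomp.classical Require Import boolp.
From mathcomp.multinomials Require Import freeg.

Set Implicit Arguments.
Unset Strict Implicit.
Unset Printing Implicit Defensive.

Import Order.TTheory GRing.Theory Num.Theory VectorInternalTheory.
Local Open Scope ring_scope.
Local Open Scope quotient_scope.

Definition biadditive (U V W : zmodType) (f : U -> V -> W) : Prop :=
  (forall y, zmod_morphism (f^~ y)) /\ (forall x, zmod_morphism (f x)).

(** The tensor product over the integers of two abelian groups: the free
    abelian group on [A * B] modulo the subgroup [tens_rel] generated by the
    bilinearity relations [tens_gen]. *)
Section Tensor.
Variables A B : zmodType.
Notation freeAB := {freeg (A * B)%type / int}.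

Definition tens_gen (z : freeAB) : Prop :=
  (exists x x' y, z = << (x + x', y) >> - << (x, y) >> - << (x', y) >>) \/
  (exists x y y', z = << (x, y + y') >> - << (x, y) >> - << (x, y') >>).

Definition tens_rel : {pred freeAB} := fun z =>
  `[< forall S : {pred freeAB}, zmod_closed S ->
        (forall g, tens_gen g -> g \in S) -> z \in S >].

Lemma tens_rel_closed : zmod_closed tens_rel.
Proof.
split=> [|x y /asboolP xS /asboolP yS]; apply/asboolP => S cS gS.
  by case: cS.
by case: (cS) => _; apply; [apply: xS | apply: yS].
Qed.

HB.instance Definition _ := GRing.isZmodClosed.Build freeAB tens_rel
  tens_rel_closed.

Definition tensor : zmodType := Quotient.quot tens_rel.

Definition tens (x : A) (y : B) : tensor :=
  \pi_(Quotient.quot tens_rel) << (x, y) >>.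

(** The homomorphism induced by [f]; meaningful when [f] is biadditive, see
    [tens_liftE] and [tens_lift_zmod_morphism]. *)
Definition tens_lift (M : zmodType) (f : A -> B -> M) (t : tensor) : M :=
  fglift (fun p => f p.1 p.2 : zmodule M) (repr t).

Lemma tens_biadditive : biadditive tens.
Proof.
suff [hl hr] : (forall x x' y, tens (x + x') y = tens x y + tens x' y) /\
               (forall x y y', tens x (y + y') = tens x y + tens x y').
  split=> [y x x'|x y y'] /=.
    by have := hl (x - x') x' y; rewrite subrK => ->; rewrite addrK.
  by have := hr x (y - y') y'; rewrite subrK => ->; rewrite addrK.
split=> [x x' y|x y y']; rewrite /tens -raddfD /=; apply/eqP;
  rewrite -Quotient.idealrBE; apply/asboolP => S _; apply.
  by left; exists x, x', y; rewrite opprD addrA.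
by right; exists x, y, y'; rewrite opprD addrA.
Qed.

Section Lift.
Variables (M : zmodType) (f : A -> B -> M).
Hypothesis fB : biadditive f.
Let f' := fglift (fun p => f p.1 p.2 : zmodule M).

Let f'B : zmod_morphism f'. Proof. exact: lift_is_additive. Qed.
Let f'0 : f' 0 = 0. Proof. by have := f'B 0 0; rewrite !subr0 subrr. Qed.

Lemma tens_lift_pi z : tens_lift f (\pi_(Quotient.quot tens_rel) z) = f' z.
Proof.
rewrite /tens_lift -/f'; apply/eqP; rewrite -subr_eq0.
have -> : f' (repr (\pi_(Quotient.quot tens_rel) z)) - f' z =
  f' (repr (\pi_(Quotient.quot tens_rel) z) - z) by rewrite f'B.
set u := _ - z.
have : u \in tens_rel by rewrite Quotient.idealrBE reprK.
move=> /asboolP /(_ [pred w | f' w == 0]); apply.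
  split=> [|x y]; rewrite !inE ?f'0 // => /eqP hx /eqP hy.
  by rewrite f'B hx hy subr0.
have [fl fr] := fB.
have addl x x' y : f (x + x') y = f x y + f x' y.
  by have := fl y (x + x') x'; rewrite addrK => /= ->; rewrite subrK.
have addr x y y' : f x (y + y') = f x y + f x y'.
  by have := fr x (y + y') y'; rewrite addrK => /= ->; rewrite subrK.
move=> g [[x [x' [y ->]]]|[x [y [y' ->]]]]; rewrite !inE !f'B /=;
  rewrite /f' !liftU !scale1r /= ?addl ?addr -addrA -opprD; exact/eqP/subrr.
Qed.

Lemma tens_liftE x y : tens_lift f (tens x y) = f x y.
Proof. by rewrite tens_lift_pi /f' liftU scale1r. Qed.

Lemma tens_lift_zmod_morphism : zmod_morphism (tens_lift f).
Proof.
move=> s t; rewrite -[s]reprK -[t]reprK -raddfB !tens_lift_pi.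
exact: f'B.
Qed.
End Lift.

End Tensor.

(** Functoriality of [tensor] in its first argument. *)
Definition tens_map (A A' B : zmodType) (phi : A -> A') :
    tensor A B -> tensor A' B :=
  tens_lift (fun x y => tens (phi x) y).

Definition ratZ : {pred rat} := fun r => r \is a Num.int.

Lemma ratZ_closed : zmod_closed ratZ.
Proof. by split=> [|x y]; [apply: rpred0 | apply: rpredB]. Qed.

HB.instance Definition _ := GRing.isZmodClosed.Build rat ratZ ratZ_closed.

Definition QmodZ : zmodType := Quotient.quot ratZ.
Definition modZ (r : rat) : QmodZ := \pi_(Quotient.quot ratZ) r.

(** [piSO k] is the stable homotopy group pi_(2k-1)(SO) as given by Bott
    periodicity; ['I_1] carries the trivial group structure. *)
Definition bott (r : nat) : zmodType :=
  match r with 0 => int | 1 => 'Z_2 | 2 => int | _ => 'I_1 end.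

Definition piSO (k : nat) : zmodType := bott (k %% 4).

Definition bott_int (r : nat) : bott r -> int :=
  match r with 0 => id | 2 => id | _ => fun=> 0 end.

(** For even [k] this is the identification of [piSO k] with [int]; for odd [k]
    it is the zero map. *)
Definition piSO_int (k : nat) : piSO k -> int := @bott_int (k %% 4).

(** The values of [k] for which the parity conditions change form. *)
Definition hopf_dim (k : nat) : bool := ((k == 2) || (k == 4))%N.

(** A [vectType int] is exactly a finitely generated free abelian group. *)
Record extqf (k : nat) := ExtQF {
  eH : vectType int;
  elam : eH -> eH -> int;
  ealpha : {additive eH -> piSO k};
  elam_biadditive : biadditive elam;
  elam_sym : forall x y, elam x y = elam y x;
  elam_parity : forall x,
    if hopf_dim k then (elam x x = piSO_int (ealpha x) %[mod 2])%Z
    else (2 %| elam x x)%Z }.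

Arguments elam [k] F x y : rename.
Arguments ealpha [k] F : rename.

(** [Hom(H, Z)]: for abelian groups, additive and [int]-linear maps agree. *)
Definition dualZ (H : vectType int) : vectType int := 'Hom(H, int^o).

Definition eadj (k : nat) (F : extqf k) (x : eH F) : dualZ (eH F) :=
  linfun (elam F x : eH F -> int^o).

Definition nondegenerate (k : nat) (F : extqf k) : Prop := injective (@eadj k F).

(** Finite nonempty trees with an integer label at each vertex. *)
Record ztree := ZTree {
  tvert : finType;
  tedge : rel tvert;
  tlabel : tvert -> int;
  tvert_neq0 : (0 < #|tvert|)%N;
  tedge_sym : symmetric tedge;
  tedge_irr : irreflexive tedge;
  tedge_connected : forall u v, connect tedge u v;
  tedge_acyclic : forall c : seq tvert, ucycle tedge c -> (size c < 3)%N }.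

Definition tgram (t : ztree) (u v : tvert t) : int :=
  if u == v then tlabel u else (tedge u v)%:R.

(** The form of [t] on the free abelian group of functions on its vertices. *)
Definition tform (t : ztree) (f g : {ffun tvert t -> int}) : int :=
  \sum_u \sum_v f u * g v * tgram u v.

Definition treelike (k : nat) (F : extqf k) : Prop :=
  exists (t : ztree) (phi : {additive {ffun tvert t -> int} -> eH F}),
    bijective phi /\ forall f g, elam F (phi f) (phi g) = tform f g.

(** For [piSO k = int] this is the identification of [G (x) int] with [G]. *)
Definition tensZ (k : nat) (G : zmodType) : tensor G (piSO k) -> G :=
  tens_lift (fun x a => x *~ piSO_int a).

(** The image of [(2 . G) (x) A] in [G (x) A]. It is only used for [A = int],
    where [(2 . G) (x) A -> G (x) A] is injective. *)
Definition in_tens2 (G A : zmodType) (t : tensor G A) : Prop :=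
  exists s : seq (G * A), t = \sum_(p <- s) tens (p.1 *+ 2) p.2.

Record extqlf (k : nat) := ExtQLF {
  lG : zmodType;
  lb : lG -> lG -> QmodZ;
  lq : lG -> QmodZ;
  lbeta : tensor lG (piSO k);
  lG_finite : exists s : seq lG, forall x, x \in s;
  lb_biadditive : biadditive lb;
  lb_sym : forall x y, lb x y = lb y x;
  lb_nonsing : forall x, (forall y, lb x y = 0) -> x = 0;
  lbeta_even : hopf_dim k -> in_tens2 lbeta;
  lq_quad : forall x y, lq (x + y) - lq x - lq y = lb x y;
  lq_opp : forall x,
    if hopf_dim k then lq x - lq (- x) = lb x (tensZ lbeta)
    else lq x = lq (- x) }.

Arguments lb [k] L x y : rename.
Arguments lq [k] L x : rename.
Arguments lbeta [k] L : rename.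

Definition extqlf_isom (k : nat) (L L' : extqlf k) : Prop :=
  exists phi : {additive lG L -> lG L'},
    [/\ bijective phi,
        forall x y, lb L' (phi x) (phi y) = lb L x y,
        forall x, lq L' (phi x) = lq L x
      & tens_map phi (lbeta L) = lbeta L'].

Section Boundary.
Variables (k : nat) (F : extqf k).
Notation H := (eH F).
Notation n := (dim H).
Implicit Types (x y h : H) (xi eta : dualZ H).

Definition im_eadj : {pred dualZ H} := fun xi => `[< exists x, xi = eadj x >].

Lemma elamBl x x' y : elam F (x - x') y = elam F x y - elam F x' y.
Proof. exact: (elam_biadditive F).1. Qed.

Lemma elamBr x y y' : elam F x (y - y') = elam F x y - elam F x y'.
Proof. exact: (elam_biadditive F).2. Qed.

Lemma additive_scalar (f : H -> int) : zmod_morphism f -> scalar (f : H -> int^o).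
Proof.
move=> fB; pose f' := GRing.isZmodMorphism.Build _ _ f fB.
pose g : {additive H -> int} := HB.pack f f'.
move=> a u v; rewrite -[f]/(g : _ -> _) raddfD; congr (_ + _).
by rewrite -[a in LHS]intz scaler_int raddfMz -mulrzr intz mulrC.
Qed.

Lemma linfunZE (f : H -> int) : zmod_morphism f ->
  forall x, linfun (f : H -> int^o) x = f x :> int.
Proof.
move=> /additive_scalar fS x.
pose f' := GRing.isLinear.Build _ _ _ _ (f : H -> int^o) fS.
pose g : {linear H -> int^o} := HB.pack (f : H -> int^o) f'.
exact: (lfunE g).
Qed.

Lemma eadjE x y : eadj x y = elam F x y :> int.
Proof. by apply: linfunZE => u v; exact: elamBr. Qed.

Lemma eadj_zmod_morphism : zmod_morphism (@eadj k F).
Proof.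
move=> x x'; apply/lfunP => y.
by rewrite add_lfunE opp_lfunE !eadjE elamBl.
Qed.

Lemma im_eadj_closed : zmod_closed im_eadj.
Proof.
split=> [|xi eta /asboolP[x ->] /asboolP[y ->]]; apply/asboolP.
  by exists 0; have := eadj_zmod_morphism 0 0; rewrite !subrr.
by exists (x - y); rewrite eadj_zmod_morphism.
Qed.

HB.instance Definition _ := GRing.isZmodClosed.Build (dualZ H) im_eadj
  im_eadj_closed.

Definition coker : zmodType := Quotient.quot im_eadj.
Definition coker_pi (xi : dualZ H) : coker := \pi_(Quotient.quot im_eadj) xi.

Definition ebasis (i : 'I_n) : H := r2v (delta_mx 0 i).
Definition edual (i : 'I_n) : dualZ H := linfun (fun x => v2r x 0 i : int^o).

(** Rational extensions in coordinates: a row vector over [rat] stands for an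
    element of [H (x) Q] in the basis [ebasis], or of [H^* (x) Q] in the dual
    basis [edual]. *)
Definition egramQ : 'M[rat]_n :=
  \matrix_(i, j) (elam F (ebasis i) (ebasis j))%:~R.
Definition elamQ (u v : 'rV[rat]_n) : rat := (u *m egramQ *m v^T) 0 0.
Definition eadjQ (u : 'rV[rat]_n) : 'rV[rat]_n := u *m egramQ.
Definition eadjQ_inv (w : 'rV[rat]_n) : 'rV[rat]_n := w *m invmx egramQ.
Definition dualQ (xi : dualZ H) : 'rV[rat]_n := \row_j (xi (ebasis j) : int)%:~R.

(** Total, but only meaningful for nondegenerate [F]. *)
Definition laminv (xi eta : dualZ H) : rat :=
  elamQ (eadjQ_inv (dualQ xi)) (eadjQ_inv (dualQ eta)).

(** [ealpha F] as an element of [H^*], for even [k]. *)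
Definition alphaZ : dualZ H :=
  linfun (fun x => piSO_int (ealpha F x) : int^o).

(** [b] and [q] are evaluated on arbitrary representatives; [bdry_bE] and
    [bdry_qE] below show that the choice is irrelevant. *)
Definition bdry_b (u v : coker) : QmodZ := modZ (laminv (repr u) (repr v)).

Definition bdry_qH (xi : dualZ H) : rat :=
  if hopf_dim k then 2^-1 * (laminv xi xi + laminv xi alphaZ)
  else 2^-1 * laminv xi xi.

Definition bdry_q (u : coker) : QmodZ := modZ (bdry_qH (repr u)).

(** The homomorphism [ealpha F : H -> A] corresponds to the element
    [\sum_i edual i (x) ealpha F (ebasis i)] of [H^* (x) A], and [bdry_beta] is
    the image of that element under [pi (x) id]; see [tensZ_bdry_beta]. *)
Definition bdry_beta : tensor coker (piSO k) :=
  \sum_i tens (coker_pi (edual i)) (ealpha F (ebasis i)).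


Lemma coker_pi_zmod_morphism : zmod_morphism coker_pi.
Proof. by move=> xi eta; rewrite /coker_pi -raddfB. Qed.

Lemma coker_pi_eq0 xi : coker_pi xi = 0 <-> exists x, xi = eadj x.
Proof.
split=> [/eqP|[x ->]].
  rewrite -[0](raddf0 \pi_(Quotient.quot im_eadj)) -Quotient.idealrBE subr0.
  by move/asboolP.
apply/eqP; rewrite -[0](raddf0 \pi_(Quotient.quot im_eadj)).
by rewrite -Quotient.idealrBE subr0; apply/asboolP; exists x.
Qed.

Lemma edualE i x : edual i x = (v2r x 0 i)%R :> int.
Proof. by apply: linfunZE => u v; rewrite raddfB !mxE. Qed.

Lemma ebasis_sum x : x = \sum_i (v2r x 0 i) *: ebasis i.
Proof.
apply: (can_inj v2rK); rewrite [in LHS](matrix_sum_delta (v2r x)) big_ord1.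
by rewrite linear_sum; apply: eq_bigr => i _; rewrite linearZ /= r2vK.
Qed.

Lemma dualZ_ext xi eta : (forall i, xi (ebasis i) = eta (ebasis i)) -> xi = eta.
Proof.
move=> h; apply/lfunP => x; rewrite [x]ebasis_sum !linear_sum.
by apply: eq_bigr => i _; rewrite !linearZ /= h.
Qed.

Lemma edual_basis i j : edual i (ebasis j) = ((i == j)%:R)%R :> int.
Proof. by rewrite edualE r2vK mxE eqxx. Qed.

Lemma edual_sum xi : xi = \sum_i (xi (ebasis i) : int) *: edual i.
Proof.
apply: dualZ_ext => j; rewrite sum_lfunE (bigD1 j) //= big1 ?addr0.
  by rewrite scale_lfunE edual_basis eqxx [RHS]mulr1.
move=> i /negPf ij; rewrite scale_lfunE edual_basis ij; exact: mulr0.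
Qed.

Definition egram : 'M[int]_n := \matrix_(i, j) elam F (ebasis i) (ebasis j).

Lemma egramQE : egramQ = map_mx intr egram.
Proof. by apply/matrixP => i j; rewrite !mxE. Qed.

Lemma egram_tr : egram^T = egram.
Proof. by apply/matrixP => i j; rewrite !mxE elam_sym. Qed.

Lemma egramQ_tr : egramQ^T = egramQ.
Proof. by apply/matrixP => i j; rewrite !mxE elam_sym. Qed.

Lemma eadj_basis x j : eadj x (ebasis j) = ((v2r x *m egram) 0 j)%R :> int.
Proof.
rewrite eadjE elam_sym -eadjE {1}[x]ebasis_sum linear_sum mxE.
apply: eq_bigr => i _; rewrite linearZ /= eadjE !mxE elam_sym; exact: erefl.
Qed.

Lemma dualQ_eadj x : dualQ (eadj x) = eadjQ (map_mx intr (v2r x)).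
Proof.
rewrite /eadjQ egramQE -map_mxM; apply/rowP => j.
by rewrite [LHS]mxE eadj_basis [RHS]mxE.
Qed.

Lemma dualQ_zmod_morphism : zmod_morphism dualQ.
Proof.
by move=> xi eta; apply/rowP => j; rewrite !mxE add_lfunE opp_lfunE rmorphB.
Qed.

Lemma eval_dualQ xi x : (xi x : int)%:~R = (map_mx intr (v2r x) *m (dualQ xi)^T) 0 0 :> rat.
Proof.
rewrite {1}[x]ebasis_sum linear_sum mxE rmorph_sum.
by apply: eq_bigr => i _; rewrite linearZ /= !mxE rmorphM.
Qed.

Hypothesis ndF : nondegenerate F.

Lemma det_egram_neq0 : \det egram != 0.
Proof.
apply/negP => /det0P[v v0 vA]; case/eqP: v0.
suff : r2v v = 0 by move/(congr1 v2r); rewrite r2vK linear0.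
apply: ndF; apply: dualZ_ext => j.
by rewrite !eadj_basis r2vK vA linear0 mul0mx.
Qed.

Lemma egramQ_unit : egramQ \in unitmx.
Proof. by rewrite unitmxE egramQE det_map_mx unitfE intr_eq0 det_egram_neq0. Qed.

Lemma laminvE xi eta :
  laminv xi eta = (dualQ xi *m invmx egramQ *m (dualQ eta)^T) 0 0.
Proof.
rewrite /laminv /elamQ /eadjQ_inv trmx_mul trmx_inv egramQ_tr !mulmxA.
by rewrite mulmxKV ?egramQ_unit.
Qed.

Lemma laminv_biadditive : biadditive laminv.
Proof.
split=> [eta xi xi'|xi eta eta']; rewrite !laminvE dualQ_zmod_morphism.
  by rewrite !mulmxBl !mxE.
by rewrite linearB /= mulmxBr !mxE.
Qed.

Lemma laminv_sym xi eta : laminv xi eta = laminv eta xi.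
Proof.
rewrite !laminvE -[in LHS](trmxK (_ *m _ *m _)) [LHS]mxE.
by rewrite !trmx_mul trmxK trmx_inv egramQ_tr mulmxA.
Qed.

Lemma laminv_eadj x xi : laminv (eadj x) xi = (xi x : int)%:~R.
Proof.
by rewrite laminvE dualQ_eadj /eadjQ mulmxK ?egramQ_unit // eval_dualQ.
Qed.

Lemma laminv_int xi : (forall eta, laminv xi eta \is a Num.int) ->
  exists x, xi = eadj x.
Proof.
move=> xiZ; pose w := dualQ xi *m invmx egramQ.
have wZ j : w 0 j \is a Num.int.
  have := xiZ (edual j); rewrite laminvE -/w mxE (bigD1 j) //= big1 => [|i ij].
    by rewrite addr0 !mxE edual_basis eqxx mulr1.
  by rewrite !mxE edual_basis eq_sym (negPf ij) mulr0.
pose u : 'rV[int]_n := \row_j Num.floor (w 0 j).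
have uw : map_mx intr u = w.
  by apply/rowP => j; rewrite [LHS]mxE [u 0 j]mxE [LHS]floorK //; exact: wZ.
exists (r2v u); have : dualQ xi = dualQ (eadj (r2v u)).
  by rewrite dualQ_eadj r2vK uw /eadjQ mulmxKV ?egramQ_unit.
move=> /rowP h; apply: dualZ_ext => j; have := h j; rewrite !mxE.
by move/(@intr_inj rat).
Qed.

Lemma alphaZE x : alphaZ x = piSO_int (ealpha F x) :> int.
Proof.
apply: linfunZE => u v; rewrite raddfB /piSO_int /piSO.
move: (ealpha F u) (ealpha F v); rewrite /piSO.
by case: (k %% 4)%N => [|[|[|r]]] //= a b; rewrite subrr.
Qed.

Lemma modZ_zmod_morphism : zmod_morphism modZ.
Proof. by move=> a b; rewrite /modZ -raddfB. Qed.

Lemma modZ_eq a b : a - b \is a Num.int -> modZ a = modZ b.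
Proof. by move=> h; apply/eqP; rewrite -Quotient.idealrBE. Qed.

Lemma modZ_eq0 a : modZ a = 0 -> a \is a Num.int.
Proof.
move/eqP; rewrite -[0](raddf0 \pi_(Quotient.quot ratZ)) -Quotient.idealrBE.
by rewrite subr0.
Qed.

Lemma repr_coker xi : exists x, repr (coker_pi xi) = xi + eadj x.
Proof.
have : repr (coker_pi xi) - xi \in im_eadj by rewrite Quotient.idealrBE reprK.
by case/asboolP => x hx; exists x; rewrite -hx addrC subrK.
Qed.

Lemma zmod_morphismD (U V : zmodType) (f : U -> V) : zmod_morphism f ->
  {morph f : x y / x + y}.
Proof. by move=> fB x y; rewrite -{2}[x](addrK y) fB subrK. Qed.

Lemma laminvDl xi xi' eta : laminv (xi + xi') eta = laminv xi eta + laminv xi' eta.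
Proof. by rewrite (zmod_morphismD (laminv_biadditive.1 eta)). Qed.

Lemma laminvDr xi eta eta' : laminv xi (eta + eta') = laminv xi eta + laminv xi eta'.
Proof. by rewrite (zmod_morphismD (laminv_biadditive.2 xi)). Qed.

Lemma laminv_eadjr x xi : laminv xi (eadj x) = (xi x : int)%:~R.
Proof. by rewrite laminv_sym laminv_eadj. Qed.

(** [b(pi x, pi y) = lambda^-1(x, y) mod Z] *)
Lemma bdry_bE xi eta : bdry_b (coker_pi xi) (coker_pi eta) = modZ (laminv xi eta).
Proof.
rewrite /bdry_b; have [x ->] := repr_coker xi; have [y ->] := repr_coker eta.
apply: modZ_eq; rewrite !(laminvDl, laminvDr) !(laminv_eadj, laminv_eadjr).
rewrite -!addrA addrC -!addrA addNr addr0 -!rmorphD; exact: rpred_int.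
Qed.

Lemma bdry_qHD xi eta :
  bdry_qH (xi + eta) = bdry_qH xi + bdry_qH eta + laminv xi eta.
Proof.
rewrite /bdry_qH !(laminvDl, laminvDr) [laminv eta xi]laminv_sym.
by case: ifP => _; field.
Qed.

Lemma bdry_qH_eadj x : bdry_qH (eadj x) \is a Num.int.
Proof.
rewrite /bdry_qH !laminv_eadj eadjE alphaZE; have := elam_parity x.
case: ifP => _.
  move=> /eqP; rewrite eqz_mod_dvd => /dvdzP[c hc].
  have -> : elam F x x = piSO_int (ealpha F x) + c * 2.
    by rewrite -hc addrC subrK.
  rewrite !rmorphD !rmorphM /=; set a := (piSO_int _)%:~R : rat.
  have -> : 2^-1 * (a + c%:~R * 2%:~R + a) = a + c%:~R by field.
  by rewrite rpredD // rpred_int.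
move=> /dvdzP[c ->]; rewrite rmorphM /=.
have -> : 2^-1 * (c%:~R * 2%:~R) = c%:~R :> rat by field.
exact: rpred_int.
Qed.

Lemma bdry_qE xi : bdry_q (coker_pi xi) = modZ (bdry_qH xi).
Proof.
rewrite /bdry_q; have [x ->] := repr_coker xi; apply: modZ_eq.
rewrite bdry_qHD laminv_eadjr -!addrA addrC -!addrA addNr addr0.
by rewrite rpredD ?bdry_qH_eadj ?rpred_int.
Qed.

Lemma coker_ind (P : coker -> Prop) : (forall xi, P (coker_pi xi)) -> forall u, P u.
Proof. by move=> h u; rewrite -[u]reprK; apply: h. Qed.

Lemma bdry_b_biadditive : biadditive bdry_b.
Proof.
split; elim/coker_ind => a; elim/coker_ind => b; elim/coker_ind => c;
  rewrite -coker_pi_zmod_morphism !bdry_bE.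
  by rewrite laminv_biadditive.1 modZ_zmod_morphism.
by rewrite laminv_biadditive.2 modZ_zmod_morphism.
Qed.

Lemma bdry_b_sym u v : bdry_b u v = bdry_b v u.
Proof. by rewrite /bdry_b laminv_sym. Qed.

Lemma bdry_b_nonsing u : (forall v, bdry_b u v = 0) -> u = 0.
Proof.
elim/coker_ind: u => xi h; apply/coker_pi_eq0/laminv_int => eta.
by apply: modZ_eq0; rewrite -bdry_bE h.
Qed.

Lemma bdry_q_quad u v : bdry_q (u + v) - bdry_q u - bdry_q v = bdry_b u v.
Proof.
elim/coker_ind: u => xi; elim/coker_ind: v => eta.
rewrite -(zmod_morphismD coker_pi_zmod_morphism) !bdry_qE bdry_bE.
rewrite -!modZ_zmod_morphism bdry_qHD; congr modZ; ring.
Qed.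

Lemma coker_finite : exists s : seq coker, forall u, u \in s.
Proof.
pose D := absz (\det egram).
pose f (r : {ffun 'I_n -> 'I_D.+1}) := coker_pi (\sum_i (r i : int) *: edual i).
exists [seq f r | r : {ffun 'I_n -> 'I_D.+1}]; elim/coker_ind => xi.
have D0 : D%:Z != 0 by rewrite eqz_nat absz_eq0 det_egram_neq0.
pose m i := (xi (ebasis i) : int).
have mlt i : (absz (m i %% D%:Z)%Z < D.+1)%N.
  by rewrite ltnW // ltnS -ltz_nat gez0_abs ?modz_ge0 // ltz_mod.
apply/imageP; exists [ffun i => Ordinal (mlt i)] => //; rewrite /f.
apply/eqP; rewrite -subr_eq0 -coker_pi_zmod_morphism; apply/eqP/coker_pi_eq0.
pose c : 'rV[int]_n := \row_i (Num.sg (\det egram) * (m i %/ D%:Z)%Z).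
exists (r2v (c *m \adj egram)); apply: dualZ_ext => j.
rewrite eadj_basis r2vK -mulmxA mul_adj_mx mul_mx_scalar.
rewrite {1}[xi]edual_sum -sumrB sum_lfunE (bigD1 j) //= big1 => [|i ij].
  rewrite addr0 -scalerBl scale_lfunE edual_basis eqxx ffunE /= !mxE.
  rewrite gez0_abs ?modz_ge0 // -/(m j) {1}(divz_eq (m j) D%:Z) addrK.
  by rewrite [LHS]mulr1 /D abszE normrEsg; ring.
by rewrite -scalerBl scale_lfunE edual_basis (negPf ij); exact: mulr0.
Qed.

Lemma piSO_int_zmod_morphism : zmod_morphism (@piSO_int k).
Proof.
rewrite /piSO_int /piSO => a b.
by case: (k %% 4)%N a b => [|[|[|r]]] //= a b; rewrite subrr.
Qed.

Lemma tensZ_biadditive (G : zmodType) :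
  biadditive (fun (x : G) (a : piSO k) => x *~ piSO_int a).
Proof.
split=> [a x y|x a b]; first by rewrite mulrzBl.
by rewrite piSO_int_zmod_morphism mulrzBr.
Qed.

Lemma zmod_morphism_sum (U V : zmodType) (f : U -> V) (I : Type) (r : seq I)
  (h : I -> U) : zmod_morphism f -> f (\sum_(i <- r) h i) = \sum_(i <- r) f (h i).
Proof.
move=> fB; apply: (big_morph f (zmod_morphismD fB)).
by have := fB 0 0; rewrite !subrr.
Qed.

Lemma zmod_morphismMz (U V : zmodType) (f : U -> V) (c : int) (z : U) :
  zmod_morphism f -> f (z *~ c) = f z *~ c.
Proof.
move=> fB; pose f' := GRing.isZmodMorphism.Build _ _ f fB.
by pose g : {additive U -> V} := HB.pack f f'; exact: (raddfMz g).
Qed.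

Lemma coker_pi_alphaZ :
  coker_pi alphaZ = \sum_i coker_pi (edual i) *~ piSO_int (ealpha F (ebasis i)).
Proof.
rewrite {1}[alphaZ]edual_sum (zmod_morphism_sum _ _ coker_pi_zmod_morphism).
apply: eq_bigr => i _; rewrite -(zmod_morphismMz _ _ coker_pi_zmod_morphism).
by rewrite -scaler_int alphaZE intz.
Qed.

(** For even [k], [bdry_beta] is [pi(alpha)] under [G (x) int = G]. *)
Lemma tensZ_bdry_beta : tensZ bdry_beta = coker_pi alphaZ.
Proof.
rewrite coker_pi_alphaZ /tensZ /bdry_beta.
rewrite (zmod_morphism_sum _ _ (tens_lift_zmod_morphism (tensZ_biadditive _))).
by apply: eq_bigr => i _; rewrite tens_liftE //; exact: tensZ_biadditive.
Qed.

Lemma bdry_q_opp u : if hopf_dim k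
  then bdry_q u - bdry_q (- u) = bdry_b u (tensZ bdry_beta)
  else bdry_q u = bdry_q (- u).
Proof.
elim/coker_ind: u => xi; have piN : - coker_pi xi = coker_pi (- xi).
  by have := coker_pi_zmod_morphism 0 xi; rewrite !sub0r => ->;
     rewrite [coker_pi 0](coker_pi_eq0 _).2 ?sub0r //; exists 0;
     have := eadj_zmod_morphism 0 0; rewrite !subrr.
have lamN eta : laminv (- xi) eta = - laminv xi eta.
  by have := laminvDl xi (- xi) eta; rewrite subrr -(subrr xi)
     laminv_biadditive.1 subrr => /esym/eqP; rewrite addrC addr_eq0 => /eqP.
have qN : bdry_qH (- xi) = if hopf_dim k then 2^-1 * (laminv xi xi - laminv xi alphaZ)
   else bdry_qH xi.
  rewrite /bdry_qH !lamN [laminv xi (- xi)]laminv_sym lamN opprK.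
  by case: ifP.
rewrite piN !bdry_qE tensZ_bdry_beta bdry_bE -modZ_zmod_morphism qN /bdry_qH.
by case: ifP => -> //; congr modZ; field.
Qed.

Lemma alphaZ_even : hopf_dim k -> exists (x : H) (xi : dualZ H),
  alphaZ = eadj x + xi *+ 2.
Proof.
move=> hk; pose A : 'M['F_2]_n := map_mx intr egram.
pose a : 'rV['F_2]_n := \row_j (alphaZ (ebasis j) : int)%:~R.
have F2 (c : int) : (c%:~R == 0 :> 'F_2) = (2 %| c)%Z.
  by rewrite -(@dvdz_pcharf _ 2) // pchar_Fp.
have lift m (B : 'M['F_2]_(m, n)) : exists C : 'M[int]_(m, n), map_mx intr C = B.
  exists (\matrix_(i, j) (B i j : nat)%:Z); apply/matrixP => i j.
  by rewrite !mxE -pmulrn natr_Zp.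
have : (a <= A)%MS.
  rewrite submxE; apply/eqP/rowP => i; rewrite [RHS]mxE.
  set W := cokermx A; have AW : A *m W = 0 by rewrite mulmx_coker.
  have [w ww] := lift _ (col i W)^T.
  have : ((elam F (r2v w) (r2v w))%:~R : 'F_2) = 0.
    rewrite -eadjE [X in eadj _ X](ebasis_sum (r2v w)) linear_sum rmorph_sum.
    under eq_bigr => j _ do rewrite linearZ /= eadj_basis !r2vK rmorphM /=.
    have -> : \sum_j (w 0 j)%:~R * ((w *m egram) 0 j)%:~R =
       (map_mx intr (w *m egram) *m (map_mx intr w)^T) 0 0 :> 'F_2.
      by rewrite [RHS]mxE; apply: eq_bigr => j _; rewrite [RHS]mulrC !mxE.
    by rewrite map_mxM ww -/A -mulmxA trmxK colE [A *m _]mulmxA AW mul0mx mulmx0 mxE.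
  move=> /eqP; rewrite F2 => lww.
  have := elam_parity (r2v w); rewrite hk => /eqP; rewrite eqz_mod_dvd.
  move=> /(rpredB lww); rewrite subKr -alphaZE => al.
  have : ((alphaZ (r2v w) : int)%:~R == 0 :> 'F_2) by rewrite F2.
  rewrite [X in alphaZ X](ebasis_sum (r2v w)) linear_sum rmorph_sum => /eqP h.
  rewrite mxE -[RHS]h; apply: eq_bigr => j _.
  rewrite linearZ /= r2vK rmorphM mulrC; congr (_ * _); last by rewrite mxE.
  by have /rowP/(_ j) := ww; rewrite !mxE.
move=> /submxP[u]; have [U <-] := lift _ u => aU.
pose y := r2v U; have h2 j : (2 %| (alphaZ (ebasis j) - eadj y (ebasis j) : int)%R)%Z.
  rewrite -F2 rmorphB subr_eq0 /= eadj_basis r2vK; apply/eqP.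
  by have /rowP/(_ j) := aU; rewrite /A -map_mxM [LHS]mxE [X in _ = X]mxE.
pose c j := ((alphaZ (ebasis j) - eadj y (ebasis j) : int) %/ 2)%Z.
exists y, (\sum_j c j *: edual j); apply: dualZ_ext => j.
rewrite add_lfunE -scaler_nat scale_lfunE sum_lfunE (bigD1 j) //= big1 => [|i ij].
  rewrite scale_lfunE edual_basis eqxx addr0.
  have /divzK := h2 j; rewrite -/(c j) => hc.
  apply/eqP; rewrite addrC -subr_eq -hc; apply/eqP.
  by rewrite [RHS]mulrC; congr (_ * _); rewrite [RHS]mulr1.
by rewrite scale_lfunE edual_basis (negPf ij); exact: mulr0.
Qed.

Lemma bdry_beta_even : hopf_dim k -> in_tens2 bdry_beta.
Proof.
move=> hk; have [x [xi hxi]] := alphaZ_even hk.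
have [one oneE] : exists one : piSO k, forall a : piSO k, a = one *~ piSO_int a.
  move: hk; rewrite /hopf_dim /piSO_int /piSO => /orP[]/eqP -> /=;
    by exists 1 => a; rewrite intz.
have tl (z : coker) (c : int) : tens z (one *~ c) = tens (z *~ c) one.
  rewrite (zmod_morphismMz _ _ ((tens_biadditive _ _).2 z)).
  by rewrite -(zmod_morphismMz _ _ ((tens_biadditive _ _).1 one)).
exists [:: (coker_pi xi, one)]; rewrite big_seq1 /bdry_beta.
under eq_bigr => i _ do rewrite [ealpha F _]oneE tl.
rewrite -(zmod_morphism_sum _ (fun i => coker_pi (edual i) *~ _)
           ((tens_biadditive _ _).1 one)) -coker_pi_alphaZ hxi.
congr tens; rewrite (zmod_morphismD coker_pi_zmod_morphism).
rewrite (coker_pi_eq0 _).2; last by exists x.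
by rewrite add0r !pmulrn (zmod_morphismMz _ _ coker_pi_zmod_morphism).
Qed.

Definition boundary : extqlf k :=
  @ExtQLF k coker bdry_b bdry_q bdry_beta coker_finite bdry_b_biadditive
    bdry_b_sym bdry_b_nonsing bdry_beta_even bdry_q_quad bdry_q_opp.

End Boundary.

(* Main.v *)
From HB Require Import structures.
From mathcomp Require Import all_boot all_order all_algebra ring lra zify.
From mathcomp.classical Require Import boolp.
Require Import Defs.

(** Only the linking form needs work. The class [beta] can be prescribed
    freely: write it as a sum of pure tensors [x (x) a], lift each [x] to a
    functional on [H], and let [alpha] be the sum of the functionals times the
    [a]. For [k = 2, 4] the class [beta] is even, [beta = 2 gamma]; replacing
    [q x] by [q x - b x gamma] makes [q] homogeneous ([q (- x) = q x]), and
    [alpha], being twice a functional, satisfies the parity condition as soon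
    as the form is even ([lq_even_opp], [boundary_isom]). So it suffices to
    realize every homogeneous nonsingular [q] on a finite group [G] by an even
    tree.

    Realizing [q] on a subgroup of [G] by a forest means giving the images [g]
    in [G] of the dual basis so that they satisfy the relations of the Gram
    matrix and so that [q] is half of the inverse form ([realizes]). Three
    constructions suffice.

    (1) A chain of vertices with even labels realizes a cyclic group of order
    [n] whose generator has square [c / n], where [n] and [c] are coprime of
    opposite parity: the labels are the quotients of a continued fraction of
    [n / c] with even partial quotients ([exists_linear], [realizes_cyclic]).

    (2) Adding a vertex that is joined to one vertex of each component replaces
    the realized group by the orthogonal complement of the cyclic subgroup
    generated by the sum of the attaching classes, if this sum has square
    [1 / N] with [N] its order, an even number ([realizes_cap]). Three chains with the same
    [n = N = 2 ^ e], joined at a vertex labelled [0], thus realize every form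
    on [(Z / N) ^ 2] which has an off-diagonal unit and no element of odd
    square: such a form becomes diagonal after adding an element of square
    [1 / N], and that element can be taken to be the sum of the three
    orthogonal generators ([realizes_plane]). The generators are found by
    solving [t (1 - t) = 2 a] in the 2-adic integers ([hensel]).

    (3) A root joined to all components and to one further leaf, both labelled
    [0], turns a forest into a tree without changing the boundary, since the
    two new vertices split off a hyperbolic plane ([realizes_treeify]).

    The realized subgroup [S] is nonsingular, so [G] is the sum of [S] and its
    orthogonal complement ([image_split]). If the complement is nonzero, it
    contains two elements [x], [y] killed by a prime power [p ^ e] with
    [b x y] of order exactly [p ^ e] ([dual_pair]). Either one of [x], [y],
    [x + y] has square of order [p ^ e] and (1) applies, or [p = 2] and (2)
    applies ([pair_summand]). Hence a maximal realized subgroup is [G]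
    ([exists_realization]). *)

Set Implicit Arguments.
Unset Strict Implicit.
Unset Printing Implicit Defensive.

Import Order.TTheory GRing.Theory Num.Theory.
Local Open Scope ring_scope.

(** * Arithmetic *)

Lemma int_parity (a : int) : exists c, a = 2 * c \/ a = 2 * c + 1.
Proof.
have := divz_eq a 2; have := modz_ge0 a (d := 2) isT.
have := ltz_mod a (d := 2) isT; set d := divz _ _; set r := modz _ _ => h1 h2 h3.
by exists d; lia.
Qed.

Lemma opposite_parity (N c u v k : int) : u * N + v * c = 1 -> N * c = 2 * k ->
  exists l, N + c = 2 * l + 1.
Proof.
move=> uv Nc; have [a ha] := int_parity N; have [d hd] := int_parity c.
case: ha hd uv Nc => -> [->|->] uv Nc.
- by exfalso; move: uv; lia.
- by exists (a + d); ring.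
- by exists (a + d); ring.
- by exfalso; move: Nc; lia.
Qed.

Lemma prime_bezout p e (c : int) : prime p -> ~~ (p%:Z %| c)%Z ->
  exists u v, u * (p ^ e)%N%:Z + v * c = 1.
Proof.
move=> pp pc; have /coprimezP[[u v] /= h] : coprimez (p ^ e)%N%:Z c.
  by rewrite coprimezE /= coprimeXl // prime_coprime // -[p]/(`|p%:Z|%N) -dvdzE.
by exists u, v.
Qed.

(** On odd [t] the derivative [1 - 2 t] of [t (1 - t)] is a unit, so a solution
    modulo [2 ^ e] lifts to one modulo [2 ^ (e + 1)]. *)
Lemma hensel e (a : int) : exists s r, let t := 2 * s + 1 in
  t * (1 - t) = 2 * a + 2 ^+ e.+1 * r.
Proof.
elim: e => [|e [s [r /= h]]]; first by exists 0, (- a); ring.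
exists (s + 2 ^+ e * r), (- 2 * s * r - 2 ^+ e * r ^+ 2); rewrite /=.
set E := 2 ^+ e in h *.
have -> : 2 ^+ e.+2 = 4 * E by rewrite /E !exprS; ring.
have hE : 2 ^+ e.+1 = 2 * E by rewrite /E exprS.
by rewrite hE in h; nra.
Qed.

Lemma mulrn_gcd (M : zmodType) (x : M) m n : x *+ m = 0 -> x *+ n = 0 ->
  x *+ gcdn m n = 0.
Proof.
move=> hm hn; have [->|m0] := posnP m; first by rewrite gcd0n.
have [u _ /dvdnP[c hc]] := Bezoutl n m0.
have : x *+ (gcdn m n + u * n) = 0 by rewrite hc mulnC mulrnA hm mul0rn.
by rewrite mulrnDr [(u * n)%N]mulnC mulrnA hn mul0rn addr0.
Qed.

(** By the pigeonhole principle each element has order at most [size s], so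
    that [(size s)`!] is an exponent. *)
Lemma finite_exponent (G : zmodType) (s : seq G) : (forall x, x \in s) ->
  exists2 D, (0 < D)%N & forall x : G, x *+ D = 0.
Proof.
move=> hs; exists (size s)`!; first exact: fact_gt0.
move=> x; pose l := [seq x *+ i | i <- iota 0 (size s).+1].
have : ~~ uniq l.
  apply/negP => ul; have := uniq_leq_size (s2 := s) ul (fun y _ => hs y).
  by rewrite size_map size_iota ltnn.
move=> /(uniqPn 0)[i [j [ij]]]; rewrite size_map size_iota => jl.
rewrite !(nth_map 0%N) ?size_iota ?(ltn_trans ij) // !nth_iota ?(ltn_trans ij) //.
rewrite !add0n => e; have d0 : x *+ (j - i) = 0.
  by rewrite (mulrnBr _ (ltnW ij)) -e subrr.
have /dvdn_fact : (0 < j - i <= size s)%N by lia.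
by case/dvdnP => c ->; rewrite mulnC mulrnA d0 mul0rn.
Qed.

Lemma modZD r s : modZ (r + s) = modZ r + modZ s.
Proof. exact: (zmod_morphismD modZ_zmod_morphism). Qed.

Lemma modZMz r m : modZ (r * m%:~R) = modZ r *~ m.
Proof. by rewrite mulrzr (zmod_morphismMz _ _ modZ_zmod_morphism). Qed.

Lemma modZ_int m : modZ m%:~R = 0.
Proof.
have h0 : modZ 0 = 0 by have := modZ_zmod_morphism 0 0; rewrite !subrr.
by rewrite -[RHS]h0; apply: modZ_eq; rewrite subr0; apply: rpred_int.
Qed.

Lemma modZ_addint r m : modZ (r + m%:~R) = modZ r.
Proof. by rewrite modZD modZ_int addr0. Qed.

(** * Forests and their forms *)

(** Rooted forests. [Cap a f] adds a root with label [2 a], joined to all the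
    roots of [f]; the doubled label makes every form even. Keeping a forest
    rather than a tree as the basic object makes orthogonal sums ([Join])
    available before the final tree is formed. *)
Inductive forest : Type :=
| Empty
| Join of forest & forest
| Cap of int & forest.

Fixpoint vert (f : forest) : finType :=
  match f with
  | Empty => void
  | Join f1 f2 => (vert f1 + vert f2)%type
  | Cap _ f1 => option (vert f1)
  end.

Fixpoint root (f : forest) : pred (vert f) :=
  match f with
  | Empty => xpred0
  | Join f1 f2 => fun v => match v with inl u => root u | inr u => root u end
  | Cap _ _ => fun v => v == None
  end.

Fixpoint gram (f : forest) : vert f -> vert f -> int :=
  match f with
  | Empty => fun _ _ => 0
  | Join f1 f2 => fun u v => match u, v with
      | inl u', inl v' => gram u' v'
      | inr u', inr v' => gram u' v'
      | _, _ => 0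
      end
  | Cap a f1 => fun u v => match u, v with
      | Some u', Some v' => gram u' v'
      | Some w, None | None, Some w => (root w)%:R
      | None, None => 2 * a
      end
  end.

Lemma gram_sym f u v : gram (f := f) u v = gram v u.
Proof.
elim: f u v => [|f1 IH1 f2 IH2|a f IH]; first by case.
  by case=> u [] v /=.
by case=> [u|] [v|] /=.
Qed.

Lemma big_option (M : nmodType) (I : finType) (F : option I -> M) :
  \sum_i F i = F None + \sum_i F (Some i).
Proof.
rewrite (bigD1 None) //=; congr (_ + _).
rewrite (reindex_omap Some id) => [|[i|] //]; apply: eq_bigl => i.
by rewrite eqxx.
Qed.

(** Values in [R^o] make this an [R]-module; through [dot] the same type also
    serves for functionals. *)
Definition vec (R : comPzRingType) (f : forest) : lmodType R :=
  {ffun vert f -> R^o}.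

Section Vectors.
Variable R : comPzRingType.
Implicit Types (f : forest).

Definition dot f (x y : vec R f) : R := \sum_v x v * y v.

(** The adjoint of the form, in coordinates. *)
Definition act f (x : vec R f) : vec R f :=
  [ffun v => \sum_u (gram v u)%:~R * x u].

(** As a functional, this is the pairing with the vertex added by [Cap]. *)
Definition rho f : vec R f := [ffun v => (root v)%:R].

Definition joinv f1 f2 (x : vec R f1) (y : vec R f2) : vec R (Join f1 f2) :=
  [ffun v : vert f1 + vert f2 => match v with inl u => x u | inr u => y u end].

Definition capv a f (c : R) (x : vec R f) : vec R (Cap a f) :=
  [ffun v : option (vert f) => if v is Some u then x u else c].

Lemma joinvP f1 f2 (x : vec R (Join f1 f2)) : exists y z, x = joinv y z.
Proof.
exists [ffun v => x (inl v)], [ffun v => x (inr v)].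
by apply/ffunP => -[v|v]; rewrite !ffunE.
Qed.

Lemma capvP a f (x : vec R (Cap a f)) : exists c y, x = capv a c y.
Proof.
exists (x None), [ffun v => x (Some v)].
by apply/ffunP => -[v|]; rewrite !ffunE.
Qed.

Lemma vec_Empty (x y : vec R Empty) : x = y.
Proof. by apply/ffunP => -[]. Qed.

Lemma vecZE f (a : R) (x : vec R f) v : (a *: x) v = a * x v.
Proof. by rewrite ffunE. Qed.

Lemma joinvD f1 f2 (x x' : vec R f1) (y y' : vec R f2) :
  joinv x y + joinv x' y' = joinv (x + x') (y + y').
Proof. by apply/ffunP => -[v|v]; rewrite !ffunE. Qed.

Lemma joinvZ f1 f2 a (x : vec R f1) (y : vec R f2) :
  a *: joinv x y = joinv (a *: x) (a *: y).
Proof. by apply/ffunP => -[v|v]; rewrite !ffunE. Qed.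

Lemma capvD a f c c' (x x' : vec R f) :
  capv a c x + capv a c' x' = capv a (c + c') (x + x').
Proof. by apply/ffunP => -[v|]; rewrite !ffunE. Qed.

Lemma capvZ a f b c (x : vec R f) : b *: capv a c x = capv a (b * c) (b *: x).
Proof. by apply/ffunP => -[v|]; rewrite !ffunE. Qed.

Lemma dotC f (x y : vec R f) : dot x y = dot y x.
Proof. by apply: eq_bigr => v _; rewrite mulrC. Qed.

Lemma dotDl f (x y z : vec R f) : dot (x + y) z = dot x z + dot y z.
Proof. by rewrite -big_split; apply: eq_bigr => v _; rewrite ffunE mulrDl. Qed.

Lemma dotDr f (x y z : vec R f) : dot z (x + y) = dot z x + dot z y.
Proof. by rewrite dotC dotDl !(dotC z). Qed.

Lemma dotZl f a (x y : vec R f) : dot (a *: x) y = a * dot x y.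
Proof. by rewrite mulr_sumr; apply: eq_bigr => v _; rewrite ffunE -mulrA. Qed.

Lemma dotZr f a (x y : vec R f) : dot x (a *: y) = a * dot x y.
Proof. by rewrite dotC dotZl dotC. Qed.

Lemma dotNr f (x y : vec R f) : dot x (- y) = - dot x y.
Proof. by rewrite -scaleN1r dotZr mulN1r. Qed.

Lemma dotNl f (x y : vec R f) : dot (- x) y = - dot x y.
Proof. by rewrite dotC dotNr dotC. Qed.

Lemma dot0l f (x : vec R f) : dot 0 x = 0.
Proof. by rewrite -(scale0r 0) dotZl mul0r. Qed.

Lemma dot_joinv f1 f2 (x x' : vec R f1) (y y' : vec R f2) :
  dot (joinv x y) (joinv x' y') = dot x x' + dot y y'.
Proof.
by rewrite /dot big_sumType; congr (_ + _); apply: eq_bigr => v _;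
   rewrite !ffunE.
Qed.

Lemma dot_capv a f c c' (x x' : vec R f) :
  dot (capv a c x) (capv a c' x') = c * c' + dot x x'.
Proof.
rewrite /dot big_option !ffunE; congr (_ + _).
by apply: eq_bigr => v _; rewrite !ffunE.
Qed.

Lemma actD f (x y : vec R f) : act (x + y) = act x + act y.
Proof.
apply/ffunP => v; rewrite !ffunE -big_split; apply: eq_bigr => u _.
by rewrite ffunE mulrDr.
Qed.

Lemma actZ f a (x : vec R f) : act (a *: x) = a *: act x.
Proof.
apply/ffunP => v; rewrite vecZE !ffunE mulr_sumr; apply: eq_bigr => u _.
by rewrite vecZE mulrCA.
Qed.

Lemma actN f (x : vec R f) : act (- x) = - act x.
Proof. by rewrite -scaleN1r actZ scaleN1r. Qed.

Lemma act_joinv f1 f2 (x : vec R f1) (y : vec R f2) :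
  act (joinv x y) = joinv (act x) (act y).
Proof.
apply/ffunP => -[v|v]; rewrite !ffunE big_sumType /=.
  rewrite [X in _ + X]big1 => [|u _]; last by rewrite mul0r.
  by rewrite addr0; apply: eq_bigr => u _; rewrite ffunE.
rewrite [X in X + _]big1 => [|u _]; last by rewrite mul0r.
by rewrite add0r; apply: eq_bigr => u _; rewrite ffunE.
Qed.

Lemma act_capv a f c (x : vec R f) :
  act (capv a c x) = capv a ((2 * a)%:~R * c + dot (rho f) x) (act x + c *: rho f).
Proof.
apply/ffunP => -[v|]; rewrite !ffunE big_option /= !ffunE.
  rewrite addrC; congr (_ + _); last by rewrite mulrC mulrz_nat.
  by apply: eq_bigr => u _; rewrite ffunE.
congr (_ + _); apply: eq_bigr => u _; by rewrite !ffunE mulrz_nat.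
Qed.

Lemma rho_joinv f1 f2 : rho (Join f1 f2) = joinv (rho f1) (rho f2).
Proof. by apply/ffunP => -[v|v]; rewrite !ffunE. Qed.

Lemma rho_capv a f : rho (Cap a f) = capv a 1 0.
Proof. by apply/ffunP => -[v|]; rewrite !ffunE. Qed.

Lemma dot_act f (x y : vec R f) : dot (act x) y = dot x (act y).
Proof.
rewrite /dot; under eq_bigr => v _ do rewrite ffunE mulr_suml.
rewrite exchange_big; apply: eq_bigr => u _; rewrite ffunE mulr_sumr.
by apply: eq_bigr => v _; rewrite gram_sym mulrCA mulrA.
Qed.

End Vectors.

Arguments rho {R f}.
Arguments capv {R} a {f} c x.

(** * Integral vectors as rational vectors *)

Definition toQ f (x : vec int f) : vec rat f := [ffun v => (x v)%:~R].

Lemma toQD f (x y : vec int f) : toQ (x + y) = toQ x + toQ y.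
Proof. by apply/ffunP => v; rewrite !ffunE rmorphD. Qed.

Lemma toQZ f a (x : vec int f) : toQ (a *: x) = a%:~R *: toQ x.
Proof. by apply/ffunP => v; rewrite !ffunE rmorphM. Qed.

Lemma toQ_rho f : toQ (rho : vec int f) = rho.
Proof. by apply/ffunP => v; rewrite !ffunE rmorph_nat. Qed.

Lemma toQ_act f (x : vec int f) : toQ (act x) = act (toQ x).
Proof.
apply/ffunP => v; rewrite !ffunE rmorph_sum; apply: eq_bigr => u _.
by rewrite ffunE rmorphM intz.
Qed.

Lemma dot_toQ f (x y : vec int f) : dot (toQ x) (toQ y) = (dot x y)%:~R.
Proof.
by rewrite rmorph_sum; apply: eq_bigr => u _; rewrite !ffunE rmorphM.
Qed.

Lemma toQ_joinv f1 f2 (x : vec int f1) (y : vec int f2) :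
  toQ (joinv x y) = joinv (toQ x) (toQ y).
Proof. by apply/ffunP => -[v|v]; rewrite !ffunE. Qed.

Lemma toQ_capv a f c (x : vec int f) : toQ (capv a c x) = capv a c%:~R (toQ x).
Proof. by apply/ffunP => -[v|]; rewrite !ffunE. Qed.

Lemma toQ_inj f : injective (@toQ f).
Proof.
move=> x y /ffunP h; apply/ffunP => v; have := h v.
by rewrite !ffunE => /intr_inj.
Qed.

Definition unitvec f (v : vert f) : vec int f := [ffun u => (u == v)%:R].

Lemma dot_unitvec f (x : vec rat f) v : dot (toQ (unitvec v)) x = x v.
Proof.
rewrite /dot (bigD1 v) //= big1 => [|u /negPf uv]; last first.
  by rewrite !ffunE uv mul0r.
by rewrite addr0 !ffunE eqxx mul1r.
Qed.

Lemma dot_unitvecZ f (x : vec int f) v : dot x (unitvec v) = x v.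
Proof.
rewrite /dot (bigD1 v) //= big1 => [|u /negPf uv]; last by rewrite !ffunE uv mulr0.
by rewrite addr0 !ffunE eqxx mulr1.
Qed.

Lemma unitvec_sum f (x : vec int f) : x = \sum_v x v *: unitvec v.
Proof.
apply/ffunP => u; rewrite sum_ffunE (bigD1 u) //= big1 => [|v /negPf vu].
  by rewrite vecZE ffunE eqxx mulr1 addr0.
by rewrite vecZE ffunE eq_sym vu mulr0.
Qed.

Lemma toQ_of_int f (x : vec rat f) : (forall v, x v \is a Num.int) ->
  exists xi, x = toQ xi.
Proof.
move=> h; exists [ffun v => Num.floor (x v)]; apply/ffunP => v.
by rewrite !ffunE floorK.
Qed.

Lemma common_denominator f (z : vec rat f) : exists2 n : int, n != 0 &
  exists w, n%:~R *: z = toQ w.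
Proof.
exists (\prod_v denq (z v)); first by apply/prodf_neq0 => v _; apply: denq_neq0.
have [|w hw] := toQ_of_int (x := (\prod_v denq (z v))%:~R *: z).
  move=> v; rewrite vecZE (bigD1 v) //= rmorphM /= mulrAC [_ * z v]mulrC -numqE.
  by rewrite rpredM ?rpred_int.
by exists w.
Qed.

(** [act] is self-adjoint, so its kernel is orthogonal to its image. *)
Lemma act_inj f : (forall xi : vec int f, exists z, act z = toQ xi) ->
  injective (@act rat f).
Proof.
move=> hs z z' hz; apply/eqP; rewrite -subr_eq0; apply/eqP/ffunP => v.
have [y hy] := hs [ffun u => (u == v)%:R].
have h0 : act (z - z') = 0 by rewrite actD actN hz subrr.
have : dot (act y) (z - z') = 0 by rewrite dot_act h0 dotC dot0l.
rewrite hy /dot (bigD1 v) //= big1 => [|u /negPf uv]; last first.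
  by rewrite !ffunE uv mul0r.
by rewrite addr0 !ffunE eqxx mul1r.
Qed.

Lemma dot_act_even f (x : vec int f) : exists c, dot x (act x) = 2 * c.
Proof.
elim: f x => [|f1 IH1 f2 IH2|a f IH] x.
- by exists 0; rewrite (vec_Empty x 0) /dot big1 // => -[].
- have [y [z ->]] := joinvP x; have [c hc] := IH1 y; have [d hd] := IH2 z.
  by exists (c + d); rewrite act_joinv dot_joinv hc hd mulrDr.
have [c [y ->]] := capvP x; have [d hd] := IH y.
exists (a * c * c + c * dot rho y + d).
rewrite act_capv dot_capv dotDr dotZr hd [dot y rho]dotC intz; ring.
Qed.

(** * Chains *)

(** The forests that arise from a chain of [Cap]s. Their cokernel is cyclic and
    generated by [rho], and [y / n] is the column of the inverse matrix at the
    root; so the generator has square [c / n]. *)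
Record linear_forest (f : forest) (n c : int) (y : vec int f) : Prop := {
  lin_act : act y = n *: rho;
  lin_dot : dot rho y = c;
  lin_gen : forall xi : vec int f, exists m w, xi = m *: rho + act w }.

(** One step [n' / n = 2 a - c / n] of a continued fraction. *)
Lemma linear_Cap a f n c y : linear_forest n c y ->
  linear_forest (f := Cap a f) (2 * a * n - c) n (capv a n (- y)).
Proof.
case=> hA hd hg; split.
- rewrite act_capv rho_capv actN hA dotNr hd capvZ intz mulr1 scaler0 addNr.
  by congr capv; ring.
- by rewrite rho_capv dot_capv dot0l mul1r addr0.
move=> xi; have [c0 [x ->]] := capvP xi; have [m [w ->]] := hg x.
exists (c0 - 2 * a * m - dot rho w), (capv a m w).
rewrite act_capv rho_capv capvZ capvD intz mulr1 scaler0 add0r addrC; congr capv.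
by ring.
Qed.

(** The recursion [n = 2 a c - c'] of [linear_Cap] is Euclidean division with an
    even quotient. It preserves the opposite parity of [n] and [c], and this
    excludes the tie [|c'| = |c|]. *)
Lemma exists_linear n c k : n + c = 2 * k + 1 ->
  exists f y, linear_forest (f := f) n c y.
Proof.
have [N leN] : exists N, (`|c| <= N)%N by exists `|c|%N.
elim: N => [|N IH] in n c k leN *.
  have -> : c = 0 by lia.
  move=> _; exists Empty, 0; split; try exact: vec_Empty.
    by rewrite /dot big1 // => -[].
  by move=> xi; exists 0, 0; apply: vec_Empty.
have [->|c0] := eqVneq c 0 => hp; first by apply: (IH n 0 k); lia.
(* [2 a] is the even number nearest to [n / c]. *)
have [a ha] : exists a : int, `|2 * a * c - n| < `|c|.
  have := divz_eq n (2 * c); have := modz_ge0 n (d := 2 * c).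
  have := ltz_mod n (d := 2 * c).
  set d := divz _ _; set r := modz _ _ => h1 h2 h3.
  have [hr|hr] := ltrP r `|c|; first by exists d; lia.
  by have [c_gt0|c_le0] := ltrP 0 c; [exists (d + 1) | exists (d - 1)]; nia.
have hp' : c + (2 * a * c - n) = 2 * (a * c + c - k - 1) + 1 by lia.
have [|f [y hy]] := IH _ _ _ _ hp'; first by lia.
exists (Cap a f); eexists; have := linear_Cap a hy.
have -> : 2 * a * c - (2 * a * c - n) = n by ring.
exact.
Qed.

(** The inverse form at [m rho + act w] is [m ^ 2 c / n] modulo even integers,
    and the functional [y / n] differs from [m c / n] by an integer. The second
    value is what [realizes_cap] subtracts. *)
Lemma linear_dot f n c y : linear_forest (f := f) n c y -> n != 0 ->
  forall m w (z : vec rat f), act z = toQ (m *: rho + act w) ->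
  exists e, dot (toQ (m *: rho + act w)) z = (m ^+ 2 * c)%:~R / n%:~R + (2 * e)%:~R
         /\ dot (toQ (m *: rho + act w)) (toQ y) = (m * c + n * dot rho w)%:~R.
Proof.
case=> hA hd _ n0 m w z hz.
have nQ : n%:~R != 0 :> rat by rewrite intr_eq0.
have hAQ : act (toQ y) = n%:~R *: rho by rewrite -toQ_act hA toQZ toQ_rho.
have hdQ : dot rho (toQ y) = c%:~R by rewrite -toQ_rho dot_toQ hd.
have rz : dot rho z = (m * c)%:~R / n%:~R + (dot rho w)%:~R.
  apply: (mulfI nQ); rewrite -dotZl -hAQ dot_act hz dot_toQ.
  rewrite dotDr dotZr [dot y rho]dotC hd -dot_act hA dotZl.
  by rewrite rmorphD !rmorphM /=; field.
have [e he] := dot_act_even w.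
exists (m * dot rho w + e); split; last first.
  by rewrite dot_toQ dotDl dotZl hd dot_act hA dotZr [dot w _]dotC.
rewrite toQD toQZ toQ_rho dotDl dotZl rz toQ_act dot_act hz dot_toQ.
rewrite dotDr he dotZr [dot w rho]dotC.
by rewrite !(rmorphD, rmorphM, rmorphXn) /=; field.
Qed.

Lemma linear_solve f n c y : linear_forest (f := f) n c y -> n != 0 ->
  forall xi : vec int f, exists z, act z = toQ xi.
Proof.
case=> hA _ hg n0 xi; have [m [w ->]] := hg xi.
exists ((m%:~R / n%:~R) *: toQ y + toQ w).
rewrite actD actZ -!toQ_act hA toQD !toQZ scalerA divfK //.
by rewrite intr_eq0.
Qed.

(** * Realizing homogeneous quadratic linking forms *)

Section Realization.

Variables (G : zmodType) (b : G -> G -> QmodZ) (q : G -> QmodZ).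
Hypothesis bB : biadditive b.
Hypothesis bC : forall x y, b x y = b y x.
Hypothesis qD : forall x y, q (x + y) = q x + q y + b x y.
Hypothesis qN : forall x, q (- x) = q x.

Lemma bDl x y z : b (x + y) z = b x z + b y z.
Proof. exact: (zmod_morphismD (bB.1 z)). Qed.

Lemma bMl x y m : b (x *~ m) y = b x y *~ m.
Proof. exact: (zmod_morphismMz (f := b^~ y) _ _ (bB.1 y)). Qed.

Lemma bMr x y m : b x (y *~ m) = b x y *~ m.
Proof. by rewrite bC bMl bC. Qed.

Lemma b0l y : b 0 y = 0.
Proof. by rewrite -(mulr0z 0) bMl. Qed.

Lemma q0 : q 0 = 0.
Proof.
have := qD 0 0; rewrite addr0 b0l addr0 => h.
by apply: (addrI (q 0)); rewrite -h addr0.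
Qed.

Lemma bxx x : b x x = q x *~ 2.
Proof.
have := qD x (- x); rewrite subrr q0 qN.
rewrite -[- x]mulrN1z bMr mulrN1z => /esym/eqP.
by rewrite subr_eq0 => /eqP <-; rewrite -mulr2n.
Qed.

Lemma qMz x m : q (x *~ m) = q x *~ (m ^+ 2).
Proof.
wlog: m / 0 <= m => [hw|].
  case: (lerP 0 m) => [|/ltW m0]; first exact: hw.
  by rewrite -[m]opprK mulrNz qN hw ?sqrrN // oppr_ge0.
case: m => // m _; elim: m => [|m IH]; first by rewrite mulr0z q0.
have -> : m.+1%:Z = m%:Z + 1 by lia.
rewrite mulrzDr mulr1z qD IH // bMl bxx -mulrzA -[X in _ + X + _]mulr1z.
by rewrite -!mulrzDr; congr (_ *~ _); ring.
Qed.

(** The homomorphism from the dual lattice to [G] that maps the dual basis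
    vector at [v] to [g v]. *)
Definition ev f (g : vert f -> G) (xi : vec int f) : G := \sum_v g v *~ xi v.

Lemma evD f (g : vert f -> G) xi eta : ev g (xi + eta) = ev g xi + ev g eta.
Proof. by rewrite -big_split; apply: eq_bigr => v _; rewrite ffunE mulrzDr. Qed.

Lemma evZ f (g : vert f -> G) a xi : ev g (a *: xi) = ev g xi *~ a.
Proof.
rewrite mulrz_suml; apply: eq_bigr => v _.
by rewrite vecZE mulrC mulrzA.
Qed.

Definition gjoin f1 f2 (g1 : vert f1 -> G) (g2 : vert f2 -> G) :
    vert (Join f1 f2) -> G :=
  fun v => match v with inl u => g1 u | inr u => g2 u end.

Definition gcap a f (x : G) (g : vert f -> G) : vert (Cap a f) -> G :=
  fun v => if v is Some u then g u else x.

Lemma ev_join f1 f2 g1 g2 (xi : vec int f1) (eta : vec int f2) :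
  ev (gjoin g1 g2) (joinv xi eta) = ev g1 xi + ev g2 eta.
Proof.
by rewrite /ev big_sumType; congr (_ + _); apply: eq_bigr => v _; rewrite !ffunE.
Qed.

Lemma ev_cap a f x g c (xi : vec int f) :
  ev (gcap x g) (capv a c xi) = x *~ c + ev g xi.
Proof.
by rewrite /ev big_option ffunE; congr (_ + _); apply: eq_bigr => v _; rewrite !ffunE.
Qed.

(** The first two fields say that the form is nondegenerate and that [ev g]
    factors through the cokernel of its adjoint. Injectivity on the cokernel
    follows from the third, the cokernel being nonsingular. The solution [z]
    stands for the inverse of the adjoint at [xi]: it is unique by [act_inj]. *)
Record realizes (f : forest) (g : vert f -> G) : Prop := Realizes {
  rz_solve : forall xi : vec int f, exists z, act z = toQ xi;
  rz_ker : forall w, ev g (act w) = 0;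
  rz_quad : forall xi z, act z = toQ xi ->
    q (ev g xi) = modZ (2^-1 * dot (toQ xi) z) }.

Lemma realizes_Empty : realizes (f := Empty) (fun _ => 0).
Proof.
split=> [xi|w|xi z _]; first by exists 0; apply: vec_Empty.
  by rewrite /ev big1 // => -[].
rewrite /ev big1 ?q0 => [|[] //]; rewrite /dot big1 => [|[] //].
by rewrite mulr0 (modZ_int 0).
Qed.

Lemma realizes_join f1 f2 g1 g2 : realizes (f := f1) g1 ->
  realizes (f := f2) g2 -> (forall xi eta, b (ev g1 xi) (ev g2 eta) = 0) ->
  realizes (gjoin g1 g2).
Proof.
case=> s1 k1 q1 [s2 k2 q2] h12; split=> [xi|w|xi z].
- have [x [y ->]] := joinvP xi; have [z hz] := s1 x; have [z' hz'] := s2 y.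
  by exists (joinv z z'); rewrite act_joinv hz hz' toQ_joinv.
- by have [x [y ->]] := joinvP w; rewrite act_joinv ev_join k1 k2 addr0.
have [x [y ->]] := joinvP xi; have [u [v ->]] := joinvP z.
rewrite act_joinv toQ_joinv ev_join qD h12 addr0 dot_joinv mulrDr modZD => h.
rewrite (q1 _ u) ?(q2 _ v) //; apply/ffunP => i.
  by move/ffunP/(_ (inr i)): h; rewrite !ffunE.
by move/ffunP/(_ (inl i)): h; rewrite !ffunE.
Qed.

(** The functional [y] takes the value [c] on [rho] and a multiple of [n] on
    the image of [act], so [x *~ v] times [y] maps [rho] to [x]. *)
Lemma linear_ev f n c y u v x : linear_forest (f := f) n c y ->
  u * n + v * c = 1 -> x *~ n = 0 ->
  exists g : vert f -> G, forall m w, ev g (m *: rho + act w) = x *~ m.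
Proof.
case=> hA hd _ uv nx; exists (fun i => x *~ v *~ y i) => m w.
have -> xi : ev (fun i => x *~ v *~ y i) xi = x *~ v *~ dot xi y.
  rewrite /dot mulrz_sumr; apply: eq_bigr => i _.
  by rewrite -mulrzA; congr (_ *~ _); exact: mulrC.
rewrite dotDl dotZl hd dot_act hA dotZr -mulrzA.
have -> : v * (m * c + n * dot w rho) = m + n * (v * dot w rho - m * u).
  by rewrite -[X in _ = X + _]mulr1 -uv; ring.
by rewrite mulrzDr mulrzA nx mul0rz addr0.
Qed.

Lemma realizes_cyclic N c k u v x : N != 0 -> N + c = 2 * k + 1 ->
  u * N + v * c = 1 -> x *~ N = 0 -> q x = modZ (c%:~R / (2 * N)%:~R) ->
  exists f (g : vert f -> G), [/\ realizes g, exists xi, ev g xi = x &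
    forall xi, exists m, ev g xi = x *~ m].
Proof.
move=> N0 hp uv Nx qx; have [f [y hy]] := exists_linear hp.
have [g hg] := linear_ev hy uv Nx.
have NQ : N%:~R != 0 :> rat by rewrite intr_eq0.
exists f, g; split; first 1 last.
- by exists (1 *: rho + act 0); rewrite hg.
- by move=> xi; have [m [w ->]] := lin_gen hy xi; exists m; rewrite hg.
split=> [|w|xi z]; first exact: linear_solve hy N0.
  by rewrite -[act w]add0r -(scale0r rho) hg.
have [m [w ->]] := lin_gen hy xi; rewrite hg qMz qx => hz.
have [e [-> _]] := linear_dot hy N0 hz.
rewrite -modZMz -(modZ_addint _ e); congr modZ.
by rewrite !(rmorphM, rmorphXn) /=; field.
Qed.

(** Let [v] be the new vertex. Over [Q] the vector [v - Y / N] is orthogonal to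
    the lattice of [f] and has square [- 1 / N]. At a functional with values [c]
    on [v] and [xi] on [f], the inverse form is thus that of [f] at [xi] plus
    [- N (c - (xi, Y) / N) ^ 2], where [(xi, Y)] is [dot xi Y]; for even [N]
    this square contributes [- (xi, Y) ^ 2 / N] modulo even integers. *)
Lemma realizes_cap f (g : vert f -> G) (Y : vec int f) N M :
  N = 2 * M -> N != 0 -> act Y = N *: rho -> dot rho Y = 1 ->
  (forall xi : vec int f, exists z, act z = toQ xi) ->
  (forall w, ev g (act w) = 0) -> ev g rho = 0 ->
  (forall xi z, act z = toQ xi ->
    q (ev g xi) =
      modZ (2^-1 * (dot (toQ xi) z - (dot xi Y)%:~R ^+ 2 / N%:~R))) ->
  realizes (gcap 0 g : vert (Cap 0 f) -> G).
Proof.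
move=> NM N0 hY hr hs hk hgr hq.
have NQ : N%:~R != 0 :> rat by rewrite intr_eq0.
have hYQ : act (toQ Y) = N%:~R *: rho by rewrite -toQ_act hY toQZ toQ_rho.
have hrQ : dot rho (toQ Y) = 1 by rewrite -toQ_rho dot_toQ hr.
have rz (xi : vec int f) z : act z = toQ xi -> dot rho z = (dot xi Y)%:~R / N%:~R.
  move=> hz; apply: (mulfI NQ); rewrite -dotZl -hYQ dot_act hz dot_toQ dotC.
  by field.
have sol c (xi : vec int f) z : act z = toQ xi ->
   act (capv 0 ((dot xi Y)%:~R - N%:~R * c%:~R)
      (z + (c%:~R - (dot xi Y)%:~R / N%:~R) *: toQ Y)) = toQ (capv 0 c xi).
  move=> hz; rewrite act_capv toQ_capv actD actZ hYQ hz dotDr dotZr hrQ (rz xi) //.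
  rewrite mulr0 mul0r; congr capv; first by ring.
  rewrite scalerA -addrA -scalerDl.
  by rewrite [X in X *: rho](_ : _ = 0) ?scale0r ?addr0 //; field.
split=> [xi|w|xi z'].
- have [c [x ->]] := capvP xi; have [z hz] := hs x; eexists; exact: sol hz.
- have [c [x ->]] := capvP w; rewrite act_capv ev_cap mul0rz add0r evD evZ hgr.
  by rewrite mul0rz addr0 hk.
have [c [x ->]] := capvP xi; have [z hz] := hs x => hz'.
rewrite ev_cap mul0rz add0r (hq x z) //.
have -> : z' = capv 0 ((dot x Y)%:~R - N%:~R * c%:~R)
      (z + (c%:~R - (dot x Y)%:~R / N%:~R) *: toQ Y).
  apply: (act_inj (f := Cap 0 f)); last by rewrite hz' sol.
  move=> xi'; have [c' [x' ->]] := capvP xi'; have [z0 hz0] := hs x'.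
  eexists; exact: sol hz0.
rewrite toQ_capv dot_capv dotDr dotZr dot_toQ.
rewrite -[in RHS](modZ_addint _ (M * c ^+ 2 - c * dot x Y)); congr modZ.
rewrite !(rmorphB, rmorphM, rmorphXn) /=.
have -> : M%:~R = N%:~R / 2 :> rat by rewrite NM rmorphM /=; field.
by field.
Qed.

(** The third generator is [l3 = - l1 - l2] with [t3 = 1 - t1 - t2]. In the sum
    of the group with a cyclic group generated by [e] of square [1 / N], the
    elements [l_i + t_i e] are orthogonal of square [t_i / N], and their sum
    is [e]. *)
Lemma realizes_plane N M s1 s2 t1 t2 l1 l2 :
  N = 2 * M -> N != 0 -> t1 = 2 * s1 + 1 -> t2 = 2 * s2 + 1 ->
  (forall s, exists u v, u * N + v * (2 * s + 1) = 1) ->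
  l1 *~ N = 0 -> l2 *~ N = 0 ->
  q l1 = modZ ((t1 * (1 - t1))%:~R / (2 * N)%:~R) ->
  q l2 = modZ ((t2 * (1 - t2))%:~R / (2 * N)%:~R) ->
  b l1 l2 = modZ (- (t1 * t2)%:~R / N%:~R) ->
  exists f (g : vert f -> G), [/\ realizes g, exists xi, ev g xi = l1 &
    forall xi, exists m n, ev g xi = l1 *~ m + l2 *~ n].
Proof.
move=> NM N0 ht1 ht2 bez Nl1 Nl2 ql1 ql2 bl.
pose t3 := 1 - t1 - t2; pose s3 := - 1 - s1 - s2.
have ht3 : t3 = 2 * s3 + 1 by rewrite /t3 /s3; lia.
pose l3 := - l1 - l2.
have Nl3 : l3 *~ N = 0 by rewrite /l3 mulrzBl mulNrz Nl1 Nl2 oppr0 addr0.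
have exP t s l : t = 2 * s + 1 -> l *~ N = 0 -> exists f y (g : vert f -> G),
    linear_forest (f := f) N t y /\ forall m w, ev g (m *: rho + act w) = l *~ m.
  move=> -> Nl; have [|f [y hy]] := @exists_linear N (2 * s + 1) (M + s).
    by rewrite NM; ring.
  have [u [v uv]] := bez s; have [g hg] := linear_ev hy uv Nl.
  by exists f, y, g.
have [f1 [y1 [g1 [L1 E1]]]] := exP _ _ _ ht1 Nl1.
have [f2 [y2 [g2 [L2 E2]]]] := exP _ _ _ ht2 Nl2.
have [f3 [y3 [g3 [L3 E3]]]] := exP _ _ _ ht3 Nl3.
have k0 f (g : vert f -> G) l : (forall m w, ev g (m *: rho + act w) = l *~ m) ->
    (ev g rho = l) * (forall w, ev g (act w) = 0).
  move=> h; split=> [|w]; last by rewrite -[act w]add0r -(scale0r rho) h.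
  have := h 1 0; rewrite scale1r mulr1z => <-.
  by rewrite -(scale0r 0) actZ !scale0r addr0.
have [r1 k1] := k0 _ _ _ E1; have [r2 k2] := k0 _ _ _ E2.
have [r3 k3] := k0 _ _ _ E3.
pose f := Join f1 (Join f2 f3); pose g := gjoin g1 (gjoin g2 g3).
pose Y : vec int f := joinv y1 (joinv y2 y3).
have evE m1 m2 m3 w1 w2 w3 : ev g (joinv (m1 *: rho + act w1)
    (joinv (m2 *: rho + act w2) (m3 *: rho + act w3))) =
    l1 *~ (m1 - m3) + l2 *~ (m2 - m3).
  rewrite !ev_join E1 E2 E3 /l3 !mulrzBr mulrzBl mulNrz.
  by rewrite [RHS]addrACA -[RHS]addrA.
have gen (xi : vec int f) : exists m1 m2 m3 w1 w2 w3,
    xi = joinv (m1 *: rho + act w1) (joinv (m2 *: rho + act w2) (m3 *: rho + act w3)).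
  have [x1 [x' ->]] := joinvP xi; have [x2 [x3 ->]] := joinvP x'.
  have [m1 [w1 ->]] := lin_gen L1 x1; have [m2 [w2 ->]] := lin_gen L2 x2.
  have [m3 [w3 ->]] := lin_gen L3 x3.
  by exists m1, m2, m3, w1, w2, w3.
exists (Cap 0 f), (gcap 0 g); split; first 1 last.
- exists (capv 0 0 (joinv (1 *: rho + act 0) (joinv (0 *: rho + act 0) (0 *: rho + act 0)))).
  by rewrite ev_cap evE !subr0 !mulr0z mulr1z addr0 add0r.
- move=> xi'; have [c [xi ->]] := capvP xi'.
  have [m1 [m2 [m3 [w1 [w2 [w3 ->]]]]]] := gen xi.
  by rewrite ev_cap evE mul0rz add0r; eexists; eexists.
apply: (realizes_cap (Y := Y) NM N0).
- by rewrite !act_joinv (lin_act L1) (lin_act L2) (lin_act L3) !rho_joinv !joinvZ.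
- rewrite !rho_joinv !dot_joinv (lin_dot L1) (lin_dot L2) (lin_dot L3) /t3; ring.
- move=> xi; have [x1 [x' ->]] := joinvP xi; have [x2 [x3 ->]] := joinvP x'.
  have [z1 h1] := linear_solve L1 N0 x1; have [z2 h2] := linear_solve L2 N0 x2.
  have [z3 h3] := linear_solve L3 N0 x3.
  by exists (joinv z1 (joinv z2 z3)); rewrite !act_joinv h1 h2 h3 !toQ_joinv.
- move=> w; have [x1 [x' ->]] := joinvP w; have [x2 [x3 ->]] := joinvP x'.
  by rewrite !act_joinv !ev_join k1 k2 k3 !addr0.
- by rewrite !rho_joinv !ev_join r1 r2 r3 /l3 -opprD addrA subrr.
move=> xi z; have [m1 [m2 [m3 [w1 [w2 [w3 ->]]]]]] := gen xi.
have [z1 [z' ->]] := joinvP z; have [z2 [z3 ->]] := joinvP z'.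
rewrite !act_joinv !toQ_joinv => h.
have h1 : act z1 = toQ (m1 *: rho + act w1).
  by apply/ffunP => i; move/ffunP/(_ (inl i)): h; rewrite !ffunE.
have h2 : act z2 = toQ (m2 *: rho + act w2).
  by apply/ffunP => i; move/ffunP/(_ (inr (inl i))): h; rewrite !ffunE.
have h3 : act z3 = toQ (m3 *: rho + act w3).
  by apply/ffunP => i; move/ffunP/(_ (inr (inr i))): h; rewrite !ffunE.
have [e1 [d1 p1]] := linear_dot L1 N0 h1.
have [e2 [d2 p2]] := linear_dot L2 N0 h2.
have [e3 [d3 p3]] := linear_dot L3 N0 h3.
rewrite evE -dot_toQ !toQ_joinv !dot_joinv d1 d2 d3 p1 p2 p3.
set D1 := dot rho w1; set D2 := dot rho w2; set D3 := dot rho w3.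
rewrite qD !qMz bMl bMr ql1 ql2 bl -!modZMz -!modZD.
(* The even integers by which the two sides differ, halved. *)
pose E := e1 + e2 + e3 - (m1 * t1 + m2 * t2 + m3 * t3) * (D1 + D2 + D3)
          - M * (D1 + D2 + D3) ^+ 2.
rewrite -[in LHS](modZ_addint _ E); congr modZ; rewrite /E /t3.
have NQ : N%:~R != 0 :> rat by rewrite intr_eq0.
have MQ : M%:~R = N%:~R / 2 :> rat by rewrite NM rmorphM /=; field.
rewrite !(rmorphD, rmorphN, rmorphM, rmorphXn) /= MQ.
by field.
Qed.

Hypothesis b_nonsing : forall x, (forall y, b x y = 0) -> x = 0.

Lemma bMnl x y m : b (x *+ m) y = b x y *+ m.
Proof. by rewrite !pmulrn bMl. Qed.

Lemma bMnr x y m : b x (y *+ m) = b x y *+ m.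
Proof. by rewrite !pmulrn bMr. Qed.

(** Polarization of [rz_quad]. *)
Lemma rz_pair f (g : vert f -> G) : realizes g -> forall xi eta z,
  act z = toQ xi -> b (ev g xi) (ev g eta) = modZ (dot (toQ eta) z).
Proof.
move=> rz xi eta z hz; have [z' hz'] := rz_solve rz eta.
have hs : act (z + z') = toQ (xi + eta) by rewrite actD hz hz' toQD.
have := rz_quad rz hs; rewrite evD qD (rz_quad rz hz) (rz_quad rz hz').
rewrite -modZD => /eqP; rewrite addrC eq_sym -subr_eq => /eqP <-.
rewrite -modZ_zmod_morphism toQD !(dotDl, dotDr); congr modZ.
have -> : dot (toQ xi) z' = dot (toQ eta) z.
  by rewrite -hz dot_act hz' dotC.
by field.
Qed.

Definition image f (g : vert f -> G) (x : G) : Prop := exists xi, ev g xi = x.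
Definition perp f (g : vert f -> G) (x : G) : Prop :=
  forall xi, b x (ev g xi) = 0.

(** If [ev g xi] pairs integrally with the image then the rational preimage of
    [xi] is integral, hence [xi] is in the image of [act]. *)
Lemma image_perp0 f (g : vert f -> G) x : realizes g -> image g x -> perp g x ->
  x = 0.
Proof.
move=> rz [xi <-] h; have [z hz] := rz_solve rz xi.
have [|w zw] := toQ_of_int (x := z).
  by move=> v; apply: modZ_eq0; rewrite -dot_unitvec -(rz_pair rz _ hz).
have /toQ_inj <- : toQ (act w) = toQ xi by rewrite toQ_act -zw.
exact: rz_ker.
Qed.

(** The homomorphism [eta |-> b x (ev g eta)] to [Q / Z] lifts to a rational
    vector [r]. It vanishes on the image of [act], so [act r] is integral, and
    [xi = act r] represents it. *)
Lemma image_split f (g : vert f -> G) x : realizes g ->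
  exists xi, perp g (x - ev g xi).
Proof.
move=> rz; pose r : vec rat f := [ffun v => repr (b x (g v))].
have br eta : b x (ev g eta) = modZ (dot (toQ eta) r).
  have bx := zmod_morphism_sum _ _ (bB.2 x).
  rewrite bx [RHS](zmod_morphism_sum _ _ modZ_zmod_morphism).
  apply: eq_bigr => v _; rewrite bMr !ffunE mulrC modZMz /modZ.
  by rewrite generic_quotient.reprK.
have [|xi hxi] := toQ_of_int (x := act r).
  move=> v; apply: modZ_eq0; rewrite -dot_unitvec dotC dot_act dotC -toQ_act.
  by rewrite -br (rz_ker rz) -[x]opprK bC -[0 : G](subrr 0) bB.1 subrr.
exists xi => eta; rewrite bB.1 br (rz_pair rz _ hxi) subrr //.
Qed.

Lemma perpD f (g : vert f -> G) x y : perp g x -> perp g y -> perp g (x + y).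
Proof. by move=> hx hy xi; rewrite bDl hx hy addr0. Qed.

Lemma perpM f (g : vert f -> G) x m : perp g x -> perp g (x *~ m).
Proof. by move=> hx xi; rewrite bMl hx mul0rz. Qed.

Lemma perp_nonsing f (g : vert f -> G) x : realizes g -> perp g x ->
  (forall y, perp g y -> b x y = 0) -> x = 0.
Proof.
move=> rz px h; apply: b_nonsing => y; have [xi hxi] := image_split y rz.
by rewrite -(subrK (ev g xi) y) bC bDl -!(bC x) h // px addr0.
Qed.

Variable D : nat.
Hypothesis D_gt0 : (0 < D)%N.
Hypothesis D_kill : forall x : G, x *+ D = 0.

(** Let [p ^ (e + 1)] be the exponent of the [p]-primary torsion of the
    complement, and let [x] have that order. Since the complement is
    nonsingular, [x *+ p ^ e] pairs nontrivially with one of its elements; a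
    [p]-primary multiple of that element is [y]. *)
Lemma dual_pair f (g : vert f -> G) t : realizes g -> perp g t -> t != 0 ->
  exists p e x y, [/\ prime p, perp g x /\ perp g y, x *+ p ^ e.+1 = 0,
    y *+ p ^ e.+1 = 0 & b x y *+ p ^ e != 0].
Proof.
move=> rz pt t0; have pM x m : perp g x -> perp g (x *+ m).
  by rewrite pmulrn; apply: perpM.
have ext : exists n, (0 < n)%N && (t *+ n == 0) by exists D; rewrite D_gt0 D_kill eqxx.
case: (ex_minnP ext) => n /andP[n0 /eqP tn] minn.
have n1 : (1 < n)%N.
  by case: n n0 tn {minn} => [|[|n]] // _; rewrite mulr1n => /eqP/negPn; rewrite t0.
pose p := pdiv n; have pp : prime p := pdiv_prime n1.
have hex : exists e, `[< forall x j, perp g x -> x *+ p ^ j = 0 -> x *+ p ^ e = 0 >].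
  exists (logn p D); apply/asboolP => x j _ xj.
  have := mulrn_gcd xj (D_kill x).
  have [m hm ->] : exists2 m, (m <= logn p D)%N & gcdn (p ^ j) D = (p ^ m)%N.
    have /(dvdn_pfactor _ _ pp)[m mj gm] := dvdn_gcdl (p ^ j) D.
    by exists m => //; rewrite -pfactor_dvdn // -gm dvdn_gcdr.
  by rewrite -(subnKC hm) expnD mulrnA => ->; rewrite mul0rn.
case: (ex_minnP hex) => e /asboolP he mine.
case: e he mine => [|e] he mine.
  have /he : perp g (t *+ (n %/ p)) by apply: pM.
  move=> /(_ 1%N); rewrite expn1 -mulrnA divnK ?pdiv_dvd // tn mulr1n => /(_ erefl) h.
  have := minn (n %/ p)%N; rewrite h eqxx andbT divn_gt0 ?pdiv_gt0 //.
  rewrite (dvdn_leq _ (pdiv_dvd n)) // => /(_ isT); rewrite leqNgt.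
  by rewrite ltn_Pdiv ?prime_gt1.
have [x [j [px xj xe]]] : exists x j, [/\ perp g x, x *+ p ^ j = 0 & x *+ p ^ e != 0].
  apply: contrapT => hn.
  suff /asboolP/mine : forall x j, perp g x -> x *+ p ^ j = 0 -> x *+ p ^ e = 0.
    by rewrite ltnn.
  move=> x j px xj; apply: contrapT => xe.
  by apply: hn; exists x, j; split => //; apply/eqP.
have [y [py bxy]] : exists y, perp g y /\ b (x *+ p ^ e) y != 0.
  apply: contrapT => hn; case/eqP: xe; apply: (perp_nonsing rz); first exact: pM.
  by move=> y py; apply: contrapT => /eqP bxy; apply: hn; exists y.
have xe1 := he x j px xj.
pose D' := (D %/ p ^ logn p D)%N.
have DE : (D' * p ^ logn p D = D)%N by rewrite divnK // pfactor_dvdnn.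
have cop : coprime p D'.
  rewrite prime_coprime // /D'; apply/negP => h.
  have : (p ^ (logn p D).+1 %| D)%N by rewrite expnS -{2}DE dvdn_mul.
  by rewrite pfactor_dvdn // ltnn.
exists p, e, x, (y *+ D'); split=> //; first by split=> //; apply: pM.
  by apply: (he _ (logn p D)); [apply: pM | rewrite -mulrnA DE].
rewrite -bMnl bMnr; apply/eqP => h; case/eqP: bxy.
have := mulrn_gcd (m := p) _ h; rewrite (eqP cop) mulr1n; apply.
by rewrite -bMnl -mulrnA -expnSr xe1 b0l.
Qed.

(** [q x] has denominator [2 N] because [2 q x = b x x]; the parity of [N c]
    comes from [q (N x) = N ^ 2 q x = 0]. *)
Lemma q_value (N : int) x : N != 0 -> x *~ N = 0 ->
  exists c k, q x = modZ (c%:~R / (2 * N)%:~R) /\ N * c = 2 * k.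
Proof.
move=> N0 Nx; have [r rE] : exists r, q x = modZ r.
  by exists (repr (q x)); rewrite /modZ generic_quotient.reprK.
have NQ : N%:~R != 0 :> rat by rewrite intr_eq0.
have /modZ_eq0/intrP[c hc] : modZ (r * (2 * N)%:~R) = 0.
  by rewrite modZMz -rE mulrzA -bxx -bMl Nx b0l.
have /modZ_eq0/intrP[k hk] : modZ (r * (N ^+ 2)%:~R) = 0.
  by rewrite modZMz -rE -qMz Nx q0.
exists c, k; split; first by rewrite rE -hc; congr modZ; rewrite rmorphM /=; field.
apply: (@intr_inj rat); rewrite !rmorphM /= -hc -hk rmorphXn rmorphM /=; ring.
Qed.

Lemma b_value (N : int) x y : N != 0 -> x *~ N = 0 ->
  exists c, b x y = modZ (c%:~R / N%:~R).
Proof.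
move=> N0 Nx; have [r rE] : exists r, b x y = modZ r.
  by exists (repr (b x y)); rewrite /modZ generic_quotient.reprK.
have NQ : N%:~R != 0 :> rat by rewrite intr_eq0.
have /modZ_eq0/intrP[c hc] : modZ (r * N%:~R) = 0.
  by rewrite modZMz -rE -bMl Nx b0l.
by exists c; rewrite rE -hc mulfK.
Qed.

Lemma cyclic_summand p e x c k : prime p -> let N := (p ^ e.+1)%N%:Z in
  x *~ N = 0 -> q x = modZ (c%:~R / (2 * N)%:~R) -> N * c = 2 * k ->
  ~~ (p%:Z %| c)%Z ->
  exists f (g : vert f -> G), [/\ realizes g, exists2 z, image g z & z != 0 &
    forall xi, exists m, ev g xi = x *~ m].
Proof.
move=> pp N Nx qx Nc pc; have [u [v uv]] := prime_bezout e.+1 pp pc.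
have [l hl] := opposite_parity uv Nc.
have N0 : N != 0 by rewrite eqz_nat -lt0n expn_gt0 prime_gt0.
have [f [g [rz im gen]]] := realizes_cyclic N0 hl uv Nx qx.
exists f, g; split=> //; exists x => //; apply: contra pc => /eqP x0.
have /modZ_eq0/intrP[d hd] : modZ (c%:~R / (2 * N)%:~R) = 0 by rewrite -qx x0 q0.
have -> : c = d * (2 * N).
  apply: (@intr_inj rat); rewrite rmorphM /= -hd divfK // intr_eq0.
  by rewrite mulf_neq0.
by rewrite dvdz_mull // dvdz_mull // /N dvdzE /= dvdn_exp.
Qed.

(** Unless [p = 2] and both squares are even, one of [x], [y], [x + y] generates
    a nonsingular cyclic group; in the remaining case a multiple of [y] and [x]
    fit [realizes_plane]. *)
Lemma pair_summand p e x y : prime p -> x *+ p ^ e.+1 = 0 -> y *+ p ^ e.+1 = 0 ->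
  b x y *+ p ^ e != 0 ->
  exists f (g : vert f -> G), [/\ realizes g, exists2 z, image g z & z != 0 &
    forall xi, exists m n, ev g xi = x *~ m + y *~ n].
Proof.
move=> pp; rewrite !pmulrn => Nx Ny bxy; set N := (p ^ e.+1)%N%:Z in Nx Ny.
have N0 : N != 0 by rewrite eqz_nat -lt0n expn_gt0 prime_gt0.
have NQ : N%:~R != 0 :> rat by rewrite intr_eq0.
have [cx [kx [qx hx]]] := q_value N0 Nx; have [cy [ky [qy hy]]] := q_value N0 Ny.
have [c hc] := b_value y N0 Nx.
have pc : ~~ (p%:Z %| c)%Z.
  apply: contra bxy => /dvdzP[d hd]; rewrite hc hd -modZMz.
  have -> : (d * p)%:~R / N%:~R * (p ^ e)%N%:~R = d%:~R :> rat.
    rewrite /N expnS PoszM !rmorphM /=; field.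
    by rewrite !pnatr_eq0 -!lt0n expn_gt0 prime_gt0.
  by rewrite modZ_int.
have [pcx|pcx] := boolP (p%:Z %| cx)%Z; last first.
  have [f [g [rz im gen]]] := cyclic_summand pp Nx qx hx pcx.
  exists f, g; split=> // xi; have [m ->] := gen xi.
  by exists m, 0; rewrite mulr0z addr0.
have [pcy|pcy] := boolP (p%:Z %| cy)%Z; last first.
  have [f [g [rz im gen]]] := cyclic_summand pp Ny qy hy pcy.
  exists f, g; split=> // xi; have [m ->] := gen xi.
  by exists 0, m; rewrite mulr0z add0r.
have [p2|podd] := even_prime pp; last first.
  (* Both squares are divisible by [p], but [2 c] is not. *)
  have Nxy : (x + y) *~ N = 0 by rewrite mulrzDl Nx Ny addr0.
  have qxy : q (x + y) = modZ ((cx + cy + 2 * c)%:~R / (2 * N)%:~R).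
    rewrite qD qx qy hc -!modZD; congr modZ.
    by rewrite !(rmorphD, rmorphM) /=; field.
  have hxy : N * (cx + cy + 2 * c) = 2 * (kx + ky + N * c).
    by rewrite mulrDr mulrDr hx hy; ring.
  have pcc : ~~ (p%:Z %| cx + cy + 2 * c)%Z.
    rewrite rpredDl ?rpredD //.
    by rewrite Gauss_dvdzr // coprimezE /= coprimen2.
  have [f [g [rz im gen]]] := cyclic_summand pp Nxy qxy hxy pcc.
  exists f, g; split=> // xi; have [m ->] := gen xi.
  by exists m, m; rewrite mulrzDl.
(* Normalize [y] to [y *~ v], so that the off-diagonal entry is [1 / N]; then
   [l1 = x] forces [t1 (1 - t1) = 2 a], and [l2] must be [- t1 t2] times the
   normalized [y], which leaves a linear condition on [t2]. *)
subst p; have [u [v uv]] := prime_bezout e.+1 pp pc.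
have /dvdzP[a ha] := pcx; have /dvdzP[d hd] := pcy.
have [s1 [r1 /=]] := hensel e.+1 a; set t1 := 2 * s1 + 1 => ht1.
have NE : N = 2 ^+ e.+1 by rewrite /N -natz natrX.
pose d1 := d * v ^+ 2.
have [w [t2 wt]] : exists w t2, w * (2 ^ e.+2)%N%:Z + t2 * (1 + 2 * d1 * t1 ^+ 2) = 1.
  apply: prime_bezout => //; rewrite rpredDr ?dvdz1 //.
  by rewrite -mulrA dvdz_mulr.
have NE2 : (2 ^ e.+2)%N%:Z = 2 * N by rewrite expnS PoszM.
rewrite NE2 in wt.
have NM : N = 2 * (2 ^ e)%N%:Z by rewrite /N expnS PoszM.
have [s2 ht2] : exists s2, t2 = 2 * s2 + 1.
  have [s2 [h|h]] := int_parity t2; last by exists s2.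
  by exfalso; move: wt; rewrite h NM; lia.
pose l2 := y *~ (- (v * t1 * t2)).
have Nl2 : l2 *~ N = 0 by rewrite /l2 -mulrzA mulrC mulrzA Ny mul0rz.
have bez s : exists u v, u * N + v * (2 * s + 1) = 1.
  by apply: prime_bezout => //; rewrite rpredDl ?dvdz_mulr.
have ql1 : q x = modZ ((t1 * (1 - t1))%:~R / (2 * N)%:~R).
  rewrite qx ha -(modZ_addint _ r1); congr modZ.
  rewrite ht1 exprS -NE !(rmorphD, rmorphM) /=; by field.
have ql2 : q l2 = modZ ((t2 * (1 - t2))%:~R / (2 * N)%:~R).
  rewrite qMz qy hd -modZMz -(modZ_addint _ (t2 * w)); congr modZ.
  have -> : 1 - t2 = 2 * d1 * t1 ^+ 2 * t2 + w * (2 * N).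
    by rewrite -[X in X - _]wt; ring.
  rewrite /d1 !(rmorphD, rmorphN, rmorphM, rmorphXn) /=; by field.
have bl : b x l2 = modZ (- (t1 * t2)%:~R / N%:~R).
  rewrite bMr hc -modZMz -(modZ_addint _ (- (u * t1 * t2))); congr modZ.
  have -> : t1 * t2 = t1 * t2 * (u * N + v * c) by rewrite uv mulr1.
  rewrite !(rmorphD, rmorphN, rmorphM, rmorphXn) /=; by field.
have [f [g [rz [xi hxi] gen]]] :=
  realizes_plane NM N0 erefl ht2 bez Nx Nl2 ql1 ql2 bl.
exists f, g; split=> //.
  exists x; first by exists xi.
  by apply: contraNneq bxy => ->; rewrite b0l mul0rz.
move=> eta; have [m [n ->]] := gen eta; exists m, (- (v * t1 * t2) * n).
by rewrite mulrzA.
Qed.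

(** A nonzero realized subgroup of the complement can be added by [Join]. *)
Lemma enlarge f (g : vert f -> G) x : realizes g -> ~ image g x ->
  exists f' (g' : vert f' -> G), [/\ realizes g', forall z, image g z -> image g' z &
    exists2 z, image g' z & ~ image g z].
Proof.
move=> rz nx; have [xi px] := image_split x rz.
have t0 : x - ev g xi != 0.
  by apply/eqP => /eqP; rewrite subr_eq0 => /eqP h; apply: nx; exists xi.
have [p [e [y [z [pp [py pz] yN zN byz]]]]] := dual_pair rz px t0.
have [f' [g' [rz' [w iw w0] gen]]] := pair_summand pp yN zN byz.
have pg eta : perp g (ev g' eta).
  by have [m [n ->]] := gen eta; apply: perpD; apply: perpM.
exists (Join f f'), (gjoin g g'); split.
- by apply: realizes_join => // a c; rewrite bC pg.
- move=> _ [a <-]; exists (joinv a 0).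
  by rewrite ev_join -(scale0r 0) evZ mulr0z addr0.
exists w.
  by have [a <-] := iw; exists (joinv 0 a); rewrite ev_join -(scale0r 0) evZ mulr0z add0r.
move=> h; case/eqP: w0; apply: (image_perp0 rz h).
by have [a <-] := iw.
Qed.

(** Each enlargement adds at least one of the finitely many elements. *)
Lemma exists_realization (s : seq G) : (forall x, x \in s) ->
  exists f (g : vert f -> G), realizes g /\ forall x, image g x.
Proof.
move=> hs.
suff H n : exists f (g : vert f -> G), realizes g /\
   ((forall x, image g x) \/
    exists l, [/\ uniq l, size l = n & forall x, x \in l -> image g x]).
  have [f [g [rz [im|[l [ul sl _]]]]]] := H (size s).+1; first by exists f, g.
  by have := uniq_leq_size (s2 := s) ul (fun x _ => hs x); rewrite sl ltnn.
elim: n => [|n [f [g [rz [im|[l [ul sl hl]]]]]]].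
- exists Empty, (fun=> 0); split; first exact: realizes_Empty.
  by right; exists [::].
- by exists f, g; split => //; left.
have [im|] := pselect (forall x, image g x); first by exists f, g; split=> //; left.
move=> /existsNP[x nx]; have [f' [g' [rz' sub [z iz nz]]]] := enlarge rz nx.
exists f', g'; split=> //; right; exists (z :: l); split=> /=.
- by rewrite ul andbT; apply/negP => /hl.
- by rewrite sl.
by move=> y; rewrite inE => /predU1P[->//|/hl/sub].
Qed.

(** The leaf is orthogonal to everything but the new root, so subtracting it
    from the old roots separates [f] from the hyperbolic plane that the two new
    vertices span. *)
Definition treeify (f : forest) : forest := Cap 0 (Join (Cap 0 Empty) f).

Lemma realizes_treeify f (g : vert f -> G) : realizes g ->
  exists g' : vert (treeify f) -> G, realizes g' /\
    forall x, image g x -> image g' x.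
Proof.
move=> rz.
(* In the separated basis the old dual vectors keep their images and those of
   the plane go to [0]; [- ev g rho] is the effect of the change of basis. *)
pose g' : vert (treeify f) -> G :=
  gcap 0 (gjoin (gcap (- ev g rho) (fun=> 0) : vert (Cap 0 Empty) -> G) g).
have form (R : comPzRingType) (x : vec R (treeify f)) : exists c d y,
    x = capv 0 c (joinv (capv 0 d 0) y).
  have [c [x' ->]] := capvP x; have [x1 [y ->]] := joinvP x'.
  have [d [z ->]] := capvP x1; exists c, d, y.
  by rewrite (vec_Empty z 0).
have evE c d y : ev g' (capv 0 c (joinv (capv 0 d 0) y)) = ev g (y - d *: rho).
  rewrite !(ev_cap, ev_join) mul0rz add0r -scaleN1r evD !evZ mulNrz mulrN1z.
  have -> : ev (f := Empty) (fun=> 0) 0 = 0 by rewrite /ev big1 // => -[].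
  by rewrite addr0 addrC.
have actE (R : comPzRingType) c d (y : vec R f) :
    act (capv 0 c (joinv (capv 0 d 0) y) : vec R (treeify f)) =
    capv 0 (d + dot rho y) (joinv (capv 0 c 0) (act y + c *: rho)).
  rewrite act_capv rho_joinv rho_capv dot_joinv dot_capv dot0l act_joinv act_capv dot0l joinvZ capvZ.
  rewrite joinvD capvD !mulr0 !mul0r !add0r !addr0 mul1r mulr1.
  by rewrite (vec_Empty (_ + _) 0).
have toE c d (y : vec int f) : toQ (capv 0 c (joinv (capv 0 d 0) y) : vec int (treeify f)) =
   capv 0 c%:~R (joinv (capv 0 d%:~R 0) (toQ y)).
  by rewrite toQ_capv toQ_joinv toQ_capv; congr (capv 0 _ (joinv (capv 0 _ _) _)); apply: vec_Empty.
exists g'; split; last first.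
  move=> x [xi <-]; exists (capv 0 0 (joinv (capv 0 0 0) xi)).
  by rewrite evE scale0r subr0.
have sol c d (y : vec int f) z : act z = toQ (y - d *: rho) ->
   act (capv 0 d%:~R (joinv (capv 0 (c%:~R - dot rho z) 0) z) : vec rat (treeify f)) =
   toQ (capv 0 c (joinv (capv 0 d 0) y) : vec int (treeify f)).
  move=> hz; rewrite actE toE hz subrK -toQ_rho -toQZ -toQD.
  by rewrite subrK.
split=> [xi|w|xi z'].
- have [c [d [y ->]]] := form _ xi; have [z hz] := rz_solve rz (y - d *: rho).
  by eexists; exact: sol hz.
- by have [c [d [y ->]]] := form _ w; rewrite actE evE addrK (rz_ker rz).
have [c [d [y ->]]] := form _ xi; have [z hz] := rz_solve rz (y - d *: rho) => hz'.
have -> : z' = capv 0 d%:~R (joinv (capv 0 (c%:~R - dot rho z) 0) z).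
  apply: (act_inj (f := treeify f)); last by rewrite hz' (sol c _ y).
  move=> xi'; have [c' [d' [y' ->]]] := form _ xi'.
  have [z0 hz0] := rz_solve rz (y' - d' *: rho); eexists; exact: sol hz0.
rewrite evE (rz_quad rz hz) toE dot_capv dot_joinv dot_capv dot0l toQD -scaleN1r !toQZ toQ_rho.
rewrite dotDl !dotZl -[RHS](modZ_addint _ (- (c * d))); congr modZ.
by rewrite !(rmorphN, rmorphM) /=; field.
Qed.

End Realization.

(** * The tree of a capped forest *)

(** Edges are described through parents because a function that increases from
    each vertex to its parent, [rank], then excludes cycles. *)
Fixpoint parent (f : forest) : vert f -> option (vert f) :=
  match f with
  | Empty => fun=> None
  | Join f1 f2 => fun v => match v with
      | inl u => omap inl (parent u)
      | inr u => omap inr (parent u)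
      end
  | Cap a f1 => omap (fun u => parent u)
  end.

Fixpoint height (f : forest) : nat :=
  match f with
  | Empty => 0
  | Join f1 f2 => maxn (height f1) (height f2)
  | Cap _ f1 => (height f1).+1
  end.

Fixpoint rank (f : forest) : vert f -> nat :=
  match f with
  | Empty => fun=> 0%N
  | Join f1 f2 => fun v => match v with inl u => rank u | inr u => rank u end
  | Cap _ f1 => fun v => if v is Some u then rank u else height f1
  end.

Lemma rank_lt f (v : vert f) : (rank v < height f)%N.
Proof.
elim: f v => [|f1 IH1 f2 IH2|a f IH]; first by case.
  by case=> v /=; rewrite leq_max ?IH1 ?IH2 ?orbT.
by case=> [v|] //=; apply: ltnW; apply: IH.
Qed.

Lemma rank_parent f (u v : vert f) : parent u = Some v -> (rank u < rank v)%N.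
Proof.
elim: f u v => [|f1 IH1 f2 IH2|a f IH]; first by case.
  by case=> u [] v /=; case pu: (parent u) => [w|] //= [<-]; auto.
case=> [u|] [v|] //= [pu]; [exact: IH | exact: rank_lt].
Qed.

Lemma rootE f (v : vert f) : root v = (parent v == None).
Proof.
elim: f v => [|f1 IH1 f2 IH2|a f IH]; first by case.
  by case=> v /=; rewrite ?IH1 ?IH2; case: (parent v).
by case.
Qed.

Definition adj (f : forest) : rel (vert f) :=
  fun u v => (parent u == Some v) || (parent v == Some u).

Lemma adj_sym f : symmetric (@adj f).
Proof. by move=> u v; rewrite /adj orbC. Qed.

Lemma adj_irr f : irreflexive (@adj f).
Proof.
by move=> u; rewrite /adj orbb; apply/negP => /eqP/rank_parent; rewrite ltnn.
Qed.

Lemma gram_offdiag f (u v : vert f) : u != v -> gram u v = (adj u v)%:R.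
Proof.
rewrite /adj; elim: f u v => [|f1 IH1 f2 IH2|a f IH]; first by case.
  have inj1 (o : option (vert f1)) w :
    (omap (@inl _ (vert f2)) o == Some (inl w)) = (o == Some w) by case: o.
  have inj2 (o : option (vert f2)) w :
    (omap (@inr (vert f1) _) o == Some (inr w)) = (o == Some w) by case: o.
  case=> u [] v /= uv; rewrite ?inj1 ?inj2 ?IH1 ?IH2 //.
    by case: (parent u) (parent v) => [?|] [?|].
  by case: (parent u) (parent v) => [?|] [?|].
case=> [u|] [v|] //= uv; first by rewrite IH.
- by rewrite rootE orbF.
- by rewrite rootE.
Qed.

Lemma adj_connect_root f (u : vert f) :
  exists2 r, parent r = None & connect (@adj f) u r.
Proof.
have [n len] : exists n, (height f - rank u <= n)%N by exists (height f - rank u)%N.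
elim: n => [|n IH] in u len *; first by have := rank_lt u; rewrite -subn_gt0; case: subn len.
case pu: (parent u) => [v|]; last by exists u.
have [|r pr cr] := IH v.
  by have := rank_parent pu; have := rank_lt v; lia.
exists r => //; apply: connect_trans cr; apply: connect1.
by rewrite /adj pu eqxx.
Qed.

(** Both neighbours on a cycle of its vertex of least rank are its parent. *)
Lemma adj_acyclic f (c : seq (vert f)) : ucycle (@adj f) c -> (size c < 3)%N.
Proof.
case/andP => cyc uc; rewrite ltnNge; apply/negP => sc.
have [v0 v0c] : exists v0, v0 \in c.
  by case: c sc {cyc uc} => // v c _; exists v; rewrite mem_head.
case: (arg_minnP (@rank f) v0c) => v vc minv.
have up u : u \in c -> adj v u -> parent v = Some u.
  move=> /minv le /orP[/eqP //|/eqP/rank_parent].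
  by rewrite ltnNge le.
have [i s hs] := rot_to vc.
have sz : (3 <= size (v :: s))%N by rewrite -hs size_rot.
have := uc; rewrite -(rot_uniq i) hs; have := cyc; rewrite -(rot_cycle i) hs.
have sub x : x \in s -> x \in c by move=> xs; rewrite -(mem_rot i) hs inE xs orbT.
case: s sz sub {hs} => [|x [|y s]] //= _ sub.
rewrite rcons_path => /and3P[vx _ /andP[_ lv]] /and3P[_ xn _].
have := up _ (sub x (mem_head _ _)) vx.
have ls : last y s \in y :: s by exact: mem_last.
rewrite (up (last y s)); first by case=> e; rewrite -e ls in xn.
  by apply: sub; rewrite inE ls orbT.
by rewrite adj_sym.
Qed.

Section CapTree.
Variables (a : int) (f : forest).
Notation t := (Cap a f).

Lemma cap_connected u v : connect (@adj t) u v.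
Proof.
have cN w : connect (@adj t) w None.
  have [r pr cr] := adj_connect_root w.
  by case: r pr cr.
by apply: connect_trans (cN u) _; rewrite (sym_connect_sym (@adj_sym t)).
Qed.

Lemma cap_gt0 : (0 < #|vert t|)%N.
Proof. by apply/card_gt0P; exists None. Qed.

Definition cap_tree : ztree :=
  ZTree (fun v : vert t => gram v v) cap_gt0 (@adj_sym t) (@adj_irr t)
    cap_connected (@adj_acyclic t).

Lemma tform_cap (x y : {ffun vert t -> int}) :
  tform (t := cap_tree) x y = dot (x : vec int t) (act (y : vec int t)).
Proof.
apply: eq_bigr => u _; rewrite ffunE mulr_sumr; apply: eq_bigr => v _.
rewrite intz -mulrA; congr (_ * _); rewrite mulrC; congr (_ * _).
by rewrite /tgram /=; case: eqVneq => [->//|uv]; exact/esym/(@gram_offdiag t).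
Qed.

End CapTree.

(** * The class beta *)

Lemma tensor_sum (A B : zmodType) (t : tensor A B) :
  exists s : seq (A * B), t = \sum_(p <- s) tens p.1 p.2.
Proof.
pose z := repr t; exists [seq (p.1 *~ freeg.coeff p z, p.2) | p <- freeg.dom z].
rewrite big_map -[LHS]generic_quotient.reprK -/z -{1}[z]freeg.freeg_sumE raddf_sum.
apply: eq_bigr => -[x y] _ /=.
rewrite (zmod_morphismMz _ _ ((tens_biadditive A B).1 y)) /tens -raddfMz /=.
by rewrite freeg.freegU_mulz intz.
Qed.

Section Presentation.
Variables (k : nat) (L : extqlf k).
Notation G := (lG L).

Lemma lbDr (x y z : G) : lb L x (y + z) = lb L x y + lb L x z.
Proof. exact: (zmod_morphismD ((lb_biadditive L).2 x)). Qed.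

(** For [k = 2, 4] this records that [beta] is even. *)
Lemma lbeta_presentation : exists s : seq (G * piSO k),
  lbeta L = \sum_(p <- s) tens (p.1 *+ (if hopf_dim k then 2 else 1)) p.2.
Proof.
case: ifP => [hk|_]; first exact: lbeta_even.
by have [s ->] := tensor_sum (lbeta L); exists s.
Qed.

Lemma tensZ_lbeta (s : seq (G * piSO k)) : hopf_dim k ->
  lbeta L = \sum_(p <- s) tens (p.1 *+ (if hopf_dim k then 2 else 1)) p.2 ->
  tensZ (lbeta L) = (\sum_(p <- s) p.1 *~ piSO_int p.2) *+ 2.
Proof.
move=> hk ->; rewrite hk -sumrMnl /tensZ.
rewrite (zmod_morphism_sum _ _ (tens_lift_zmod_morphism (tensZ_biadditive k G))).
apply: eq_bigr => p _; rewrite tens_liftE; last exact: tensZ_biadditive.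
by rewrite !pmulrn -!mulrzA mulrC.
Qed.

End Presentation.

(** * The lattice of a forest *)

Section Lattice.
Variables (k : nat) (f : forest).
Notation H := ({ffun vert f -> int^o} : vectType int).

Definition fform (x y : H) : int := dot (x : vec int f) (act (y : vec int f)).

Lemma fform_biadditive : biadditive fform.
Proof.
split=> [y x x'|x y y']; rewrite /fform.
  by rewrite dotDl dotNl.
by rewrite actD actN dotDr dotNr.
Qed.

Lemma fform_sym x y : fform x y = fform y x.
Proof. by rewrite /fform -dot_act dotC. Qed.

Variable alpha : {additive H -> piSO k}.
Hypothesis alpha_even : hopf_dim k -> forall x, (2 %| piSO_int (alpha x))%Z.

Lemma fform_parity x :
  if hopf_dim k then (fform x x = piSO_int (alpha x) %[mod 2])%Z
  else (2 %| fform x x)%Z.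
Proof.
have e : (2 %| fform x x)%Z.
  by have [c hc] := dot_act_even (x : vec int f); rewrite /fform hc dvdz_mulr.
case: ifP => // hk; apply/eqP; rewrite eqz_mod_dvd.
by rewrite rpredB // alpha_even.
Qed.

Definition lattice : extqf k :=
  ExtQF fform_biadditive fform_sym fform_parity.

Notation F := lattice.

Definition coords (xi : dualZ (eH F)) : vec int f :=
  [ffun v => xi (unitvec v : H)].

Definition functional (x : vec int f) : dualZ (eH F) :=
  linfun (fun y : H => dot x (y : vec int f) : int^o).

Lemma coordsE (xi : dualZ (eH F)) (x : H) : xi x = dot (coords xi) x :> int.
Proof.
rewrite [x in LHS](unitvec_sum x) linear_sum; apply: eq_bigr => v _.
by rewrite linearZ /= ffunE mulrC.
Qed.

Lemma coords_inj : injective coords.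
Proof. by move=> xi eta h; apply/lfunP => x; rewrite !coordsE h. Qed.

Lemma functionalE x (y : H) : functional x y = dot x y :> int.
Proof. by apply: linfunZE => u v; rewrite dotDr dotNr. Qed.

Lemma functionalK : cancel functional coords.
Proof. by move=> x; apply/ffunP => v; rewrite ffunE functionalE dot_unitvecZ. Qed.

Lemma coordsD (xi eta : dualZ (eH F)) : coords (xi + eta) = coords xi + coords eta.
Proof. by apply/ffunP => v; rewrite !ffunE add_lfunE. Qed.

Lemma coords_eadj (x : H) : coords (eadj (F := F) x) = act (x : vec int f).
Proof.
apply/ffunP => v; rewrite [LHS]ffunE eadjE /= fform_sym /fform dotC.
by rewrite dot_unitvecZ.
Qed.

Hypothesis solv : forall xi : vec int f, exists z, act z = toQ xi.

Lemma lattice_nondegenerate : nondegenerate F.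
Proof.
move=> x y /(congr1 coords); rewrite !coords_eadj => h.
by apply: (@toQ_inj f); apply: (act_inj solv); rewrite -!toQ_act h.
Qed.

(** Clear the denominators of [z] and use that the inverse form pairs the image
    of the adjoint integrally. *)
Lemma laminv_solve xi eta z : act z = toQ (coords xi) ->
  laminv (F := F) xi eta = dot (toQ (coords eta)) z.
Proof.
move=> hz; have [n n0 [w hw]] := common_denominator z.
have nQ : n%:~R != 0 :> rat by rewrite intr_eq0.
have hx : eadj (F := F) w = xi *~ n.
  apply: coords_inj; rewrite coords_eadj; apply: (@toQ_inj f).
  rewrite toQ_act -hw actZ hz -toQZ; congr toQ; apply/ffunP => v.
  by rewrite vecZE !ffunE -scaler_int scale_lfunE intz.
have := laminv_eadj lattice_nondegenerate w eta.
rewrite hx (zmod_morphismMz _ _ ((laminv_biadditive lattice_nondegenerate).1 eta)).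
move=> h; apply: (mulfI nQ); rewrite mulrzl h coordsE -dotZr hw dot_toQ //.
Qed.

End Lattice.

(** * Comparison of the boundary with the given linking form *)

Lemma sub2_eq (M : zmodType) (a b c d : M) : a - b - c = d -> a = b + c + d.
Proof. by move=> <-; rewrite -[a - b - c]addrA -opprD [RHS]addrC subrK. Qed.

Section Homogeneous.
Variables (k : nat) (L : extqlf k) (gam : lG L).
Hypothesis gamE : hopf_dim k -> tensZ (lbeta L) = gam *+ 2.

(** Completing the square: the linear term of [q] is [b] with half of [beta]. *)
Definition lq_even (x : lG L) : QmodZ :=
  lq L x - (if hopf_dim k then lb L x gam else 0).

Lemma lq_even_quad x y : lq_even (x + y) = lq_even x + lq_even y + lb L x y.
Proof.
rewrite /lq_even (sub2_eq (lq_quad x y)); case: ifP => _; last by rewrite !subr0.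
rewrite (zmod_morphismD ((lb_biadditive L).1 gam)).
by rewrite /= addrAC opprD addrACA.
Qed.

Lemma lq_even_opp x : lq_even (- x) = lq_even x.
Proof.
rewrite /lq_even; have := lq_opp x; case: ifP => [hh|_ ->] //.
rewrite gamE // mulr2n lbDr => h.
have bN : lb L (- x) gam = - lb L x gam.
  have := (lb_biadditive L).1 gam 0 x; rewrite sub0r => ->.
  by have := (lb_biadditive L).1 gam 0 0; rewrite !subrr => ->; rewrite sub0r.
by rewrite bN opprK -(subrK (lq L (- x)) (lq L x)) h addrAC addrK addrC.
Qed.

End Homogeneous.

Section Comparison.
Variables (k : nat) (L : extqlf k) (s : seq (lG L * piSO k)).
Notation mult := (if hopf_dim k then 2 else 1)%N.
Hypothesis hs : lbeta L = \sum_(p <- s) tens (p.1 *+ mult) p.2.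
Notation gam := (\sum_(p <- s) p.1 *~ piSO_int p.2).
Variables (f : forest) (g : vert f -> lG L).
Hypothesis rz : realizes (lq_even gam) g.
Hypothesis im : forall x, image g x.
Notation H := ({ffun vert f -> int^o} : vectType int).

Definition lift (x : lG L) : vec int f := sval (cid (im x)).

Lemma liftK x : ev g (lift x) = x.
Proof. exact: svalP (cid (im x)). Qed.

(** This functional goes to [beta] under the projection to the cokernel, whatever
    the lifts. For [k = 2, 4] the factor [mult] makes it even, as required over
    an even form. *)
Definition lift_alpha_fun (h : H) : piSO k :=
  \sum_(p <- s) p.2 *~ (mult%:Z * dot (lift p.1) h).

Lemma lift_alpha_zmod_morphism : zmod_morphism lift_alpha_fun.
Proof.
move=> x y; rewrite /lift_alpha_fun -sumrB; apply: eq_bigr => p _.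
by rewrite dotDr dotNr mulrBr mulrzBr.
Qed.

HB.instance Definition _ := GRing.isZmodMorphism.Build H (piSO k) lift_alpha_fun
  lift_alpha_zmod_morphism.

Definition lift_alpha : {additive H -> piSO k} := lift_alpha_fun.

Lemma piSO_int_lift_alpha h : piSO_int (lift_alpha h) =
  mult%:Z * dot (\sum_(p <- s) piSO_int p.2 *: lift p.1) h.
Proof.
rewrite /lift_alpha /= /lift_alpha_fun.
rewrite (zmod_morphism_sum _ _ (@piSO_int_zmod_morphism k)).
have -> : dot (\sum_(p <- s) piSO_int p.2 *: lift p.1) h =
    \sum_(p <- s) piSO_int p.2 * dot (lift p.1) h.
  elim/big_rec2: _ => [|p y x _ <-]; first by rewrite dot0l.
  by rewrite dotDl dotZl.
rewrite mulr_sumr; apply: eq_bigr => p _.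
rewrite (zmod_morphismMz _ _ (@piSO_int_zmod_morphism k)) mulrzz.
by rewrite mulrCA.
Qed.

Lemma lift_alpha_even : hopf_dim k -> forall x, (2 %| piSO_int (lift_alpha x))%Z.
Proof. by move=> hk x; rewrite piSO_int_lift_alpha hk dvdz_mulr. Qed.

Definition lift_form : extqf k := lattice lift_alpha_even.
Notation F := lift_form.

Definition lift_nd : nondegenerate F :=
  lattice_nondegenerate (alpha_even := lift_alpha_even) (rz_solve rz).

Definition ev_dual (xi : dualZ (eH F)) : lG L := ev g (coords xi).

Lemma ev_dualD xi eta : ev_dual (xi + eta) = ev_dual xi + ev_dual eta.
Proof. by rewrite /ev_dual coordsD evD. Qed.

Lemma ev_dual_functional x : ev_dual (functional lift_alpha_even (lift x)) = x.
Proof. by rewrite /ev_dual functionalK liftK. Qed.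

Lemma ev_gam : ev g (\sum_(p <- s) piSO_int p.2 *: lift p.1) = gam.
Proof.
elim/big_rec2: _ => [|p y x _ <-]; first by rewrite -(scale0r 0) evZ mulr0z.
by rewrite evD evZ liftK.
Qed.

Lemma coords_alphaZ : coords (alphaZ F) =
  mult%:Z *: \sum_(p <- s) piSO_int p.2 *: lift p.1.
Proof.
apply/ffunP => v; rewrite ffunE alphaZE piSO_int_lift_alpha vecZE.
by rewrite dot_unitvecZ.
Qed.

(** The term [laminv xi alpha / 2] of the boundary restores the linear term that
    was removed from [q]. *)
Lemma lq_ev_dual xi : modZ (bdry_qH (F := F) xi) = lq L (ev_dual xi).
Proof.
have [z hz] := rz_solve rz (coords xi).
have := rz_quad rz hz; rewrite -/(ev_dual xi) => hq.
rewrite /bdry_qH !(laminv_solve (rz_solve rz) _ hz).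
rewrite coords_alphaZ toQZ dotZl.
case: ifP hq => [hk|hk]; rewrite /lq_even hk; last by rewrite subr0.
move/eqP; rewrite subr_eq => /eqP ->; rewrite -ev_gam.
rewrite (rz_pair (@lq_even_quad _ L gam) rz _ hz).
by rewrite -modZD; congr modZ; field.
Qed.

(** Both bilinear forms are the polarizations of their quadratic refinements. *)
Lemma lb_ev_dual xi eta :
  bdry_b (coker_pi xi) (coker_pi eta) = lb L (ev_dual xi) (ev_dual eta).
Proof.
rewrite -(bdry_q_quad lift_nd) -(zmod_morphismD (@coker_pi_zmod_morphism _ _)).
by rewrite !(bdry_qE lift_nd) !lq_ev_dual ev_dualD lq_quad.
Qed.

Lemma coker_pi_ev xi eta : ev_dual xi = ev_dual eta -> coker_pi xi = coker_pi eta.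
Proof.
move=> h; apply/eqP; rewrite -subr_eq0; apply/eqP/(bdry_b_nonsing lift_nd).
elim/coker_ind => z; rewrite (bdry_b_biadditive lift_nd).1 !lb_ev_dual h.
exact: subrr.
Qed.

Lemma ev_coker_pi xi eta : coker_pi xi = coker_pi eta -> ev_dual xi = ev_dual eta.
Proof.
move=> /eqP; rewrite -subr_eq0 -coker_pi_zmod_morphism => /eqP/coker_pi_eq0[h hh].
by rewrite -(subrK eta xi) hh ev_dualD /ev_dual coords_eadj (rz_ker rz) add0r.
Qed.

(** The inverse of the map induced by [ev_dual]; it is defined through a choice
    of lifts, and [to_cokerE] shows that the choice is immaterial. *)
Definition to_coker (x : lG L) : coker F :=
  coker_pi (functional lift_alpha_even (lift x)).

Lemma to_cokerE xi : to_coker (ev_dual xi) = coker_pi xi.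
Proof. by apply: coker_pi_ev; rewrite ev_dual_functional. Qed.

Lemma to_coker_ind (P : lG L -> Prop) : (forall xi, P (ev_dual xi)) ->
  forall x, P x.
Proof. by move=> h x; rewrite -(ev_dual_functional x). Qed.

Lemma to_coker_zmod_morphism : zmod_morphism to_coker.
Proof.
elim/to_coker_ind => xi; elim/to_coker_ind => eta.
have -> : ev_dual xi - ev_dual eta = ev_dual (xi - eta).
  by apply/eqP; rewrite subr_eq -ev_dualD subrK.
by rewrite !to_cokerE coker_pi_zmod_morphism.
Qed.

HB.instance Definition _ := GRing.isZmodMorphism.Build (lG L) (coker F) to_coker
  to_coker_zmod_morphism.

Lemma to_coker_bijective : bijective to_coker.
Proof.
exists (fun u => ev_dual (repr u)) => [|u].
  elim/to_coker_ind => xi; rewrite to_cokerE; apply: ev_coker_pi.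
  exact: generic_quotient.reprK.
by rewrite to_cokerE; exact: generic_quotient.reprK.
Qed.

Lemma to_coker_beta : tens_map to_coker (lbeta L) = lbeta (boundary lift_nd).
Proof.
have tB : biadditive (fun (x : lG L) (a : piSO k) => tens (to_coker x) a).
  split=> [a x y|x]; last exact: (tens_biadditive _ _).2.
  by rewrite to_coker_zmod_morphism (tens_biadditive _ _).1.
rewrite hs /tens_map (zmod_morphism_sum _ _ (tens_lift_zmod_morphism tB)).
rewrite /= /bdry_beta.
under [RHS]eq_bigr => i _ do
  rewrite (zmod_morphism_sum _ _ ((tens_biadditive _ _).2 _)).
rewrite exchange_big; apply: eq_bigr => p _ /=; rewrite tens_liftE //.
pose xi := functional lift_alpha_even (lift p.1).
have -> : p.1 *+ mult = ev_dual (xi *+ mult).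
  rewrite -{1}(ev_dual_functional p.1) -/xi; elim: mult => [|m IH].
    by rewrite !mulr0n; apply: (addrI (ev_dual 0)); rewrite -ev_dualD !addr0.
  by rewrite !mulrSr ev_dualD IH.
rewrite to_cokerE {1}[xi](edual_sum xi) -sumrMnl.
rewrite (zmod_morphism_sum _ _ (@coker_pi_zmod_morphism _ _)).
rewrite (zmod_morphism_sum _ _ ((tens_biadditive _ _).1 _)).
apply: eq_bigr => i _.
rewrite (zmod_morphismMz _ _ ((tens_biadditive _ _).2 _)).
rewrite -(zmod_morphismMz _ _ ((tens_biadditive _ _).1 _)).
rewrite -(zmod_morphismMz _ _ (@coker_pi_zmod_morphism _ _)).
congr (tens (coker_pi _) _); rewrite pmulrn -scaler_int intz -scaler_int intz scalerA.
by congr (_ *: _); rewrite functionalE.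
Qed.

Lemma boundary_isom : extqlf_isom L (boundary lift_nd).
Proof.
exists to_coker; split.
- exact: to_coker_bijective.
- elim/to_coker_ind => xi; elim/to_coker_ind => eta.
  by rewrite /= !to_cokerE lb_ev_dual.
- by elim/to_coker_ind => xi; rewrite /= to_cokerE (bdry_qE lift_nd) lq_ev_dual.
exact: to_coker_beta.
Qed.

End Comparison.

Theorem theorem5p12 (k : nat) (hk : (2 <= k)%N) (L : extqlf k) :
  exists (F : extqf k) (ndF : nondegenerate F),
    treelike F /\ extqlf_isom L (boundary ndF).
Proof.
have [e eP] := lG_finite L; have [D D0 DK] := finite_exponent eP.
have [s hs] := lbeta_presentation L.
have gamE (h : hopf_dim k) := tensZ_lbeta h hs.
have bB := lb_biadditive L; have bC := @lb_sym _ L.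
have qD := @lq_even_quad k L (\sum_(p <- s) p.1 *~ piSO_int p.2).
have qN := @lq_even_opp k L _ gamE.
have [f [g [rz im]]] := exists_realization bB bC qD qN (@lb_nonsing _ L) D0 DK eP.
have [g' [rz' im']] := realizes_treeify rz.
have im2 x : image g' x by exact: im'.
exists (lift_form s im2), (lift_nd (im := im2) rz').
split; last exact: boundary_isom.
exists (cap_tree 0 (Join (Cap 0 Empty) f)).
pose idH : {additive {ffun vert (treeify f) -> int} -> {ffun vert (treeify f) -> int^o}} := idfun.
exists idH; split; first by exists id.
by move=> x y; rewrite tform_cap.
Qed.
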